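(* Let $n\ge 4$ be an integer and take $H\cong P_n$. Let $G\in\lambda_n$ be a minimally $n$-convergent graph such that $g(HL(G))>4$. If every component of $G$ is unicyclic, then every component of $HL(G)$ is unicyclic.
   Context: All graphs are finite, simple and undirected. $P_n$ is the path on $n$ vertices. Fix $H\cong P_n$. Two edges of a graph $G$ are $P_n$-adjacent if they are distinct, share an endpoint, and both lie in a common subgraph of $G$ isomorphic to $P_n$. The graph $HL(G)$ has vertex set $E(G)$, with two vertices adjacent iff the corresponding edges are $P_n$-adjacent in $G$ (if $G$ has no edges, $HL(G)$ is the graph with no vertices). Set $HL^0(G)=G$ and $HL^{k+1}(G)=HL(HL^k(G))$. The sequence $\{HL^k(G)\}$ terminates if some $HL^k(G)$ is empty; it converges if it does not terminate and there is an integer $N$ with $HL^N(G)\cong HL^{N+1}(G)$. $\Lambda_n$ is the set of graphs $G$ whose sequence converges. A graph $G$ is minimally $n$-convergent if $G\in\Lambda_n$ but no proper subgraph of $G$ is in $\Lambda_n$; $\lambda_n$ is the set of minimally $n$-convergent graphs. A connected graph is unicyclic if it contains exactly one cycle. The girth $g(G)$ is the length of a shortest cycle of $G$ (infinite if there is none). *)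

(* Defs.v *)
From mathcomp Require Import all_boot.

Set Implicit Arguments.
Unset Strict Implicit.
Unset Printing Implicit Defensive.

Record sgraph := SGraph {
  vertex :> finType;
  adj : rel vertex;
  adj_sym : symmetric adj;
  adj_irrefl : irreflexive adj }.

(* Equal cardinals make the injection [f] a bijection. *)
Definition isomorphic (G1 G2 : sgraph) : bool :=
  [exists f : {ffun G1 -> G2},
    [&& injectiveb f, #|G1| == #|G2| &
        [forall x, forall y, adj (f x) (f y) == adj x y]]].

Lemma isomorphicP (G1 G2 : sgraph) :
  reflect (exists2 f : G1 -> G2, bijective f & {mono f : x y / adj x y})
          (isomorphic G1 G2).
Proof.
apply: (iffP existsP) => [[f /and3P[/injectiveP fi /eqP c /forallP m]]|].
  exists f; last by move=> x y; apply/eqP; move/forallP: (m x).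
  by apply: inj_card_bij => //; rewrite c.
case=> f fb m; exists (finfun f); apply/and3P; split.
- by apply/injectiveP => x y; rewrite !ffunE; exact: (bij_inj fb).
- by apply/eqP; exact: bij_eq_card fb.
- by apply/forallP => x; apply/forallP => y; rewrite !ffunE m.
Qed.

Definition edges (G : sgraph) : {set {set G}} :=
  [set e | [exists x, exists y, adj x y && (e == [set x; y])]].

Lemma edgesE (G : sgraph) (x y : G) : ([set x; y] \in edges G) = adj x y.
Proof.
rewrite inE; apply/existsP/idP => [[a /existsP[b /andP[ab /eqP E]]]|xy]; last first.
  by exists x; apply/existsP; exists y; rewrite xy eqxx.
have: a \in [set x; y] by rewrite E set21.
have: b \in [set x; y] by rewrite E set22.
have: x \in [set a; b] by rewrite -E set21.
have: y \in [set a; b] by rewrite -E set22.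
have ba : adj b a by rewrite adj_sym.
rewrite !inE => /orP[]/eqP-> /orP[]/eqP-> //; rewrite ?orbb => /eqP A /eqP B;
  by move: ab; rewrite ?A ?B ?adj_irrefl // -?A -?B ?adj_irrefl.
Qed.

(* A subgraph is a set of vertices together with a set of edges joining them. *)
Definition is_subgraph (G : sgraph) (S : {set G} * {set {set G}}) : bool :=
  (S.2 \subset edges G) && [forall e in S.2, e \subset S.1].

Definition subgraph (G : sgraph) := {S | is_subgraph (G := G) S}.

Definition sub_vertices (G : sgraph) (S : subgraph G) : {set G} := (val S).1.
Definition sub_edges (G : sgraph) (S : subgraph G) : {set {set G}} := (val S).2.

Definition sub_adj (G : sgraph) (S : subgraph G) :
    rel {x : G | x \in sub_vertices S} :=
  fun x y => [set val x; val y] \in sub_edges S.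

Lemma sub_adj_sym (G : sgraph) (S : subgraph G) : symmetric (sub_adj (S := S)).
Proof. by move=> x y; rewrite /sub_adj setUC. Qed.

Lemma sub_adj_irrefl (G : sgraph) (S : subgraph G) :
  irreflexive (sub_adj (S := S)).
Proof.
move=> x; apply/negP => xx; case/andP: (valP S) => /subsetP/(_ _ xx).
by rewrite edgesE adj_irrefl.
Qed.

Definition sub_sgraph (G : sgraph) (S : subgraph G) : sgraph :=
  SGraph (sub_adj_sym (S := S)) (sub_adj_irrefl (S := S)).

Definition proper_subgraph (G : sgraph) (S : subgraph G) : bool :=
  (sub_vertices S != [set: G]) || (sub_edges S != edges G).

Definition path_adj (n : nat) : rel 'I_n :=
  fun i j => (i.+1 == j :> nat) || (j.+1 == i :> nat).

Lemma path_adj_sym n : symmetric (@path_adj n).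
Proof. by move=> i j; rewrite /path_adj orbC. Qed.

Lemma path_adj_irrefl n : irreflexive (@path_adj n).
Proof. by move=> i; rewrite /path_adj orbb gtn_eqF. Qed.

Definition path_graph (n : nat) : sgraph :=
  SGraph (@path_adj_sym n) (@path_adj_irrefl n).

(* This is the cycle C_k only for k >= 3. *)
Definition cycle_adj (k : nat) : rel 'I_k :=
  fun i j => (i != j) && ((ordS i == j) || (ordS j == i)).

Lemma cycle_adj_sym k : symmetric (@cycle_adj k).
Proof. by move=> i j; rewrite /cycle_adj eq_sym orbC. Qed.

Lemma cycle_adj_irrefl k : irreflexive (@cycle_adj k).
Proof. by move=> i; rewrite /cycle_adj eqxx. Qed.

Definition cycle_graph (k : nat) : sgraph :=
  SGraph (@cycle_adj_sym k) (@cycle_adj_irrefl k).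

Definition is_cycle (G : sgraph) : bool :=
  (2 < #|G|) && isomorphic G (cycle_graph #|G|).

(* [None] stands for infinite girth. *)
Definition girth (G : sgraph) : option nat :=
  if [pick C : subgraph G | is_cycle (sub_sgraph C)] is Some C0 then
    Some #|sub_vertices
             [arg min_(C < C0 | is_cycle (sub_sgraph C)) #|sub_vertices C|]|
  else None.

Definition girth_gt (G : sgraph) (m : nat) : bool :=
  if girth G is Some g then m < g else true.

Definition connected (G : sgraph) : bool :=
  (0 < #|G|) && [forall x : G, forall y : G, connect (@adj G) x y].

Definition unicyclic (G : sgraph) : bool :=
  connected G && (#|[set C : subgraph G | is_cycle (sub_sgraph C)]| == 1).

Definition induced_pair (G : sgraph) (A : {set G}) : {set G} * {set {set G}} :=
  (A, [set e in edges G | e \subset A]).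

Lemma induced_proof (G : sgraph) (A : {set G}) : is_subgraph (induced_pair A).
Proof.
rewrite /is_subgraph /=; apply/andP; split.
  by apply/subsetP => e; rewrite inE => /andP[].
by apply/forall_inP => e; rewrite inE => /andP[].
Qed.

Definition induced (G : sgraph) (A : {set G}) : subgraph G :=
  exist _ (induced_pair A) (induced_proof A).

Definition component (G : sgraph) (x : G) : sgraph :=
  sub_sgraph (induced [set y | connect (@adj G) x y]).

Definition all_components_unicyclic (G : sgraph) : Prop :=
  forall x : G, unicyclic (component x).

Definition path_adjacent (n : nat) (G : sgraph) (e1 e2 : {set G}) : bool :=
  [&& e1 != e2, e1 :&: e2 != set0 &
      [exists S : subgraph G,
        [&& isomorphic (sub_sgraph S) (path_graph n),
            e1 \in sub_edges S & e2 \in sub_edges S]]].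

Definition HL_adj (n : nat) (G : sgraph) : rel {e : {set G} | e \in edges G} :=
  fun e1 e2 => path_adjacent n (val e1) (val e2).

Lemma HL_adj_sym n (G : sgraph) : symmetric (@HL_adj n G).
Proof.
move=> e1 e2; rewrite /HL_adj /path_adjacent eq_sym setIC.
by congr [&& _, _ & _]; apply: eq_existsb => S; congr andb; rewrite andbC.
Qed.

Lemma HL_adj_irrefl n (G : sgraph) : irreflexive (@HL_adj n G).
Proof. by move=> e; rewrite /HL_adj /path_adjacent eqxx. Qed.

Definition HL (n : nat) (G : sgraph) : sgraph :=
  SGraph (@HL_adj_sym n G) (@HL_adj_irrefl n G).

Definition HL_iter (n k : nat) (G : sgraph) : sgraph := iter k (HL n) G.

Definition terminates (n : nat) (G : sgraph) : Prop :=
  exists k, #|HL_iter n k G| = 0.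

Definition convergent (n : nat) (G : sgraph) : Prop :=
  ~ terminates n G /\
  exists N, isomorphic (HL_iter n N G) (HL_iter n N.+1 G).

Definition minimally_convergent (n : nat) (G : sgraph) : Prop :=
  convergent n G /\
  forall S : subgraph G, proper_subgraph S -> ~ convergent n (sub_sgraph S).

(* Main.v *)
(* Write HL(G) as the edge-disjoint union over the vertices v of G of the links of v, i.e. the
   P_n-adjacencies between edges meeting at v. Since HL(G) has girth at least 5 and G is
   unicyclic, every link is a forest, so HL(G) has at most sum_v (deg v - 1) = 2|E(G)| - |V(G)|
   edges, which is at most |E(G)| = |V(HL(G))|. It then suffices that no component K of HL(G) is
   a tree. Suppose K is one; its vertices form a set of edges of G which every P_n either
   contains or avoids, so deleting them from G deletes K from HL(G). A forest whose HL-graph is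
   not a forest contains a spider with three legs, any two of which carry a P_n; from there on
   every pair of incident edges is P_n-adjacent, so HL acts as the line graph operator and the
   iterates grow without bound. Hence the iterates of the tree K terminate or are unbounded. The
   latter contradicts the convergence of G; in the former case G minus the edges in K is still
   convergent, contradicting minimality. *)
Require Import Defs.
From mathcomp Require Import all_boot zify.

Set Implicit Arguments.
Unset Strict Implicit.
Unset Printing Implicit Defensive.

(** * Edge deletion, components and cycles of a relation *)

(** Girth alone keeps only cycles of length 3 and 4 out of a link. Longer ones are excluded because
    a link is nearly a threshold graph: [vx] and [vy] are [P_n]-adjacent as soon as the longest arms
    beyond [x] and [y] are together long enough, provided that no path avoiding [v] joins [x] to
    [y]. Unicyclicity allows one exceptional pair of neighbours at each [v]; in a forest there is
    none, so there a triangle-free link is acyclic. That all incident pairs remain adjacent under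
    [HL] is not automatic: a [P_n] has only [n - 1] edges, so it yields a path one vertex too short
    in the line graph, and another edge has to be inserted. Hence the invariant of the growth
    argument also asks for [n] edges and for connectedness. The bound [4 <= n] gives one of the
    three legs a second edge; for [n = 3] the claw would become a triangle, which is stationary.
    Isomorphisms between iterates are handled as mutual embeddings of finite graphs, which are
    compatible with [HL] and with deletion of edges. *)

Lemma eq_set2 (T : finType) (a b x y : T) :
  ([set a; b] == [set x; y]) = (a == x) && (b == y) || (a == y) && (b == x).
Proof.
apply/eqP/idP => [E|/orP[]/andP[/eqP-> /eqP->]//]; last by rewrite setUC.
have: a \in [set x; y] by rewrite -E set21.
have: b \in [set x; y] by rewrite -E set22.
have: x \in [set a; b] by rewrite E set21.
have: y \in [set a; b] by rewrite E set22.
rewrite !inE => /orP[]/eqP-> /orP[]/eqP->; rewrite ?eqxx ?orbT ?andbT //=;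
  by rewrite ?orbb => /eqP-> /eqP->; rewrite ?eqxx.
Qed.

Lemma adj_neq (G : sgraph) (x y : G) : adj x y -> x != y.
Proof. by apply: contraTneq => ->; rewrite adj_irrefl. Qed.

(* Counts ordered pairs: twice the number of edges of a graph. *)
Definition narcs (T : finType) (r : rel T) := #|[set p : T * T | r p.1 p.2]|.

Definition cclass (T : finType) (r : rel T) (x : T) := [set y | connect r x y].

Definition ncomp (T : finType) (r : rel T) := #|[set cclass r x | x : T]|.

Definition del (T : finType) (r : rel T) (x y : T) : rel T :=
  fun a b => r a b && ([set a; b] != [set x; y]).

Definition acyclic (T : finType) (r : rel T) :=
  forall s, uniq s -> 2 < size s -> cycle r s -> False.

Lemma del_sym (T : finType) (r : rel T) x y :
  symmetric r -> symmetric (del r x y).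
Proof. by move=> sr a b; rewrite /del sr setUC. Qed.

Lemma del_irr (T : finType) (r : rel T) x y :
  irreflexive r -> irreflexive (del r x y).
Proof. by move=> ir a; rewrite /del ir. Qed.

Lemma sub_del (T : finType) (r : rel T) x y : subrel (del r x y) r.
Proof. by move=> a b /andP[]. Qed.

Lemma sub_connect_del (T : finType) (r : rel T) x y :
  subrel (connect (del r x y)) (connect r).
Proof. by apply: connect_sub => a b /sub_del /connect1. Qed.

Lemma sub_acyclic (T : finType) (r r' : rel T) :
  subrel r' r -> acyclic r -> acyclic r'.
Proof. by move=> sub ac s us ss /(sub_cycle sub); exact: ac. Qed.

Lemma narcs_del (T : finType) (r : rel T) x y :
  symmetric r -> irreflexive r -> r x y -> narcs r = (narcs (del r x y)).+2.
Proof.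
move=> sr ir rxy; have xy : x != y by apply: contraTneq rxy => ->; rewrite ir.
rewrite /narcs (cardsD1 (x, y)) inE rxy (cardsD1 (y, x)) !inE -sr rxy.
rewrite xpair_eqE (negPf xy) andbF /= add1n; congr _.+2.
apply: eq_card => -[a b]; rewrite !inE /= /del eq_set2 !xpair_eqE negb_or.
by rewrite [RHS]andbC andbA [X in X && _]andbC.
Qed.

Lemma ncomp_connect (T : finType) (r r' : rel T) :
  connect r =2 connect r' -> ncomp r = ncomp r'.
Proof.
move=> E; rewrite /ncomp; congr #|pred_of_set _|; apply: eq_imset => x.
by apply/setP => y; rewrite !inE E.
Qed.

Lemma connect_del (T : finType) (r : rel T) x y : symmetric r ->
  connect (del r x y) x y -> connect (del r x y) =2 connect r.
Proof.
move=> sr cxy a b; apply/idP/idP; first exact: sub_connect_del.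
apply: connect_sub => {}a {}b rab.
have sd := sym_connect_sym (del_sym x y sr).
case: (boolP ([set a; b] != [set x; y])) => [ne|]; first by rewrite connect1 // /del rab.
by rewrite negbK eq_set2 => /orP[]/andP[/eqP-> /eqP->]; rewrite // sd.
Qed.

Lemma connect_class (T : finType) (r : rel T) x y : symmetric r ->
  (cclass r x == cclass r y) = connect r x y.
Proof.
move=> sr; have sc := sym_connect_sym sr; apply/eqP/idP => [/setP/(_ y)|c].
  by rewrite !inE connect0.
by apply/setP => z; rewrite !inE (same_connect sc c).
Qed.

(** A walk from [a] to [b] need cross the edge [xy] at most once, in one of the two directions. *)
Lemma connect_delP (T : finType) (r : rel T) x y a b : symmetric r -> r x y ->
  connect r a b = [|| connect (del r x y) a b,
    connect (del r x y) a x && connect (del r x y) y b |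
    connect (del r x y) a y && connect (del r x y) x b].
Proof.
move=> sr rxy; apply/idP/idP; last first.
  have cxy := connect1 rxy.
  have cyx : connect r y x by rewrite connect1 // sr.
  case/or3P=> [|/andP[u v]|/andP[u v]]; first exact: sub_connect_del.
    exact: connect_trans (sub_connect_del u) (connect_trans cxy (sub_connect_del v)).
  exact: connect_trans (sub_connect_del u) (connect_trans cyx (sub_connect_del v)).
case/connectP => p; elim: p a => [|c p IH] a /=; first by move=> _ ->; rewrite connect0.
case/andP=> rac pp lp; have := IH _ pp lp.
case: (boolP ([set a; c] != [set x; y])) => [ne|].
  have cac : connect (del r x y) a c by rewrite connect1 // /del rac.
  case/or3P=> [u|/andP[u ->]|/andP[u ->]]; rewrite (connect_trans cac u) ?orbT //.
  rewrite negbK eq_set2 => /orP[]/andP[/eqP-> /eqP->]; rewrite !connect0 /=.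
    by case/or3P=> [->|/andP[_ ->]|->]; rewrite ?orbT.
  by case/or3P=> [->|->|/andP[_ ->]]; rewrite ?orbT.
Qed.

(** If the ends stay connected, no class changes. Otherwise the class of [x] splits into those of
    [x] and [y], and the remaining classes are the same for both relations. *)
Lemma ncomp_del (T : finType) (r : rel T) x y : symmetric r -> r x y ->
  ncomp (del r x y) = ncomp r + ~~ connect (del r x y) x y.
Proof.
move=> sr rxy; case: (boolP (connect _ x y)) => [c|nc].
  by rewrite addn0; apply: ncomp_connect; exact: connect_del.
set d := del r x y in nc *; have sd : symmetric d by exact: del_sym.
have sc := sym_connect_sym sd; have scr := sym_connect_sym sr.
rewrite /ncomp [in RHS](cardsD1 (cclass r x)) imset_f //.
rewrite [in LHS](cardsD1 (cclass d x)) imset_f //.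
rewrite [X in _ + X = _](cardsD1 (cclass d y)) !inE imset_f // andbT.
rewrite connect_class // sc nc /= addn1 !add1n; congr _.+2.
apply: eq_card => A; rewrite !inE; apply/and3P/andP.
  case=> Ay Ax /imsetP[z _ E]; move: Ay Ax.
  rewrite E !connect_class // => zy zx.
  have EA : cclass d z = cclass r z.
    apply/setP => w; rewrite !inE (connect_delP _ _ sr rxy) -/d.
    by rewrite (negPf zx) (negPf zy) /= orbF.
  rewrite EA; split; last by apply/imsetP; exists z.
  rewrite connect_class // (connect_delP _ _ sr rxy) -/d.
  by rewrite (negPf zx) (negPf zy).
case=> Ax /imsetP[z _ E]; move: Ax; rewrite E connect_class //.
rewrite (connect_delP _ _ sr rxy) -/d connect0 andbT => /norP[zx /norP[_ zy]].
have EA : cclass d z = cclass r z.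
  apply/setP => w; rewrite !inE (connect_delP _ _ sr rxy) -/d.
  by rewrite (negPf zx) (negPf zy) /= orbF.
rewrite -EA !connect_class // zx zy; split=> //; by apply/imsetP; exists z.
Qed.

Lemma ncomp_narcs0 (T : finType) (r : rel T) : narcs r = 0 -> ncomp r = #|T|.
Proof.
move=> /eqP; rewrite cards_eq0 => /eqP/setP r0.
have rN x y : r x y = false by have := r0 (x, y); rewrite !inE.
rewrite /ncomp card_imset // => x y /setP/(_ x); rewrite !inE connect0.
case/esym/connectP=> -[|c p] /=; first by [].
by rewrite rN.
Qed.

Lemma narcs_gt0 (T : finType) (r : rel T) : 0 < narcs r -> exists x y, r x y.
Proof.
by rewrite card_gt0 => /set0Pn[[x y]]; rewrite inE; exists x, y.
Qed.

(** The difference of the two sides is twice the cyclomatic number. Deleting a bridge preserves it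
    and deleting any other edge lowers it by 2; the lemmas below show in the same way that it is 0
    for a forest, at least 2 if there is a cycle and at least 4 if there are two different ones. *)
Lemma leq_ncomp_narcs (T : finType) (r : rel T) : symmetric r -> irreflexive r ->
  2 * #|T| <= 2 * ncomp r + narcs r.
Proof.
have [m le] := ubnP (narcs r); elim: m r le => // m IH r le sr ir.
case: (posnP (narcs r)) => [r0|/narcs_gt0[x [y rxy]]]; first by rewrite (ncomp_narcs0 r0); lia.
have E := narcs_del sr ir rxy; have C := ncomp_del sr rxy.
have: 2 * #|T| <= 2 * ncomp (del r x y) + narcs (del r x y).
  by apply: IH; [lia | exact: del_sym | exact: del_irr].
lia.
Qed.

Lemma connect_del_cycle (T : finType) (r : rel T) x y : symmetric r -> irreflexive r ->
  r x y -> connect (del r x y) x y ->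
  exists2 p, [/\ uniq (x :: p), 1 < size p & last x p = y] & cycle r (x :: p).
Proof.
move=> sr ir rxy /connectP[p pp lp]; case: (shortenP pp) lp => q pq uq _ lq.
exists q.
  split=> //; case: q pq lq uq => [|a [|b q]] //= pq lq _.
    by rewrite lq ir in rxy.
  by case/andP: pq; rewrite lq /del eqxx andbF.
by rewrite /= rcons_path -lq sr rxy andbT; apply: sub_path pq; exact: sub_del.
Qed.

Lemma ncomp_narcs_acyclic (T : finType) (r : rel T) : symmetric r -> irreflexive r ->
  acyclic r -> 2 * ncomp r + narcs r = 2 * #|T|.
Proof.
have [m le] := ubnP (narcs r); elim: m r le => // m IH r le sr ir ac.
case: (posnP (narcs r)) => [r0|/narcs_gt0[x [y rxy]]]; first by rewrite (ncomp_narcs0 r0) r0; lia.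
have E := narcs_del sr ir rxy; have := ncomp_del sr rxy.
case: (boolP (connect _ x y)) => [c|_].
  have [p [up sp _] cp] := connect_del_cycle sr ir rxy c.
  by case: (ac (x :: p)).
have: 2 * ncomp (del r x y) + narcs (del r x y) = 2 * #|T|.
  apply: IH; [lia | exact: del_sym | exact: del_irr |].
  by apply: sub_acyclic ac; exact: sub_del.
lia.
Qed.

(** The rest of the cycle leads from [next s a] back to [a]. Only its last edge meets [a], and that
    edge comes from the predecessor of [a], which differs from [next s a] because the cycle has more
    than two vertices. *)
Lemma cycle_connect_del (T : finType) (r : rel T) s a : uniq s -> 2 < size s ->
  symmetric r -> cycle r s -> a \in s -> connect (del r a (next s a)) a (next s a).
Proof.
move=> us ss sr cs sa; have [i t Et] := rot_to sa.
rewrite -(next_rot i us) Et.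
have: uniq (a :: t) by rewrite -Et rot_uniq.
have: cycle r (a :: t) by rewrite -Et rot_cycle.
have: 2 < size (a :: t) by rewrite -Et size_rot.
case: t {Et} => [|b [|c t]] //= _; rewrite eqxx => /andP[_ /andP[rbc]].
rewrite rcons_path => /andP[pt rla] /andP[].
rewrite !inE !negb_or => /and3P[ab ac at'] /andP[/andP[bc bt] /andP[ct _]].
have sd := sym_connect_sym (del_sym a b sr).
have ne u v : u != a -> v != a -> [set u; v] != [set a; b].
  by move=> ua va; rewrite eq_set2 (negPf ua) (negPf va) !andbF.
rewrite sd; apply: connect_trans (_ : connect _ b (last c t)) _; last first.
  rewrite connect1 // /del rla eq_set2 (negPf ab) !andbF eqxx andbT /=.
  by apply: contraNneq (_ : b \notin c :: t) => [<-|]; rewrite ?mem_last // !inE negb_or bc.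
apply/connectP; exists (c :: t) => //=; rewrite {1}/del rbc /= ne 1?eq_sym //=.
have : all (fun z => z != a) (c :: t).
  by rewrite /= eq_sym ac; apply/allP => z zt; apply: contraNneq at' => <-.
elim: t c pt {rbc rla ac bc ct at' bt} => //= d t IH c /andP[rcd pt] /and3P[ca da ta].
by rewrite {1}/del rcd ne //=; apply: IH => //=; rewrite da.
Qed.

Lemma leq_ncomp_cycle (T : finType) (r : rel T) s : symmetric r -> irreflexive r ->
  uniq s -> 2 < size s -> cycle r s -> 2 * #|T| + 2 <= 2 * ncomp r + narcs r.
Proof.
move=> sr ir us; case: s us => // a s us ss cs.
have rab : r a (next (a :: s) a) by apply: next_cycle; rewrite ?mem_head.
have cd := cycle_connect_del us ss sr cs (mem_head _ _).
have := leq_ncomp_narcs (del_sym a (next (a :: s) a) sr) (del_irr _ _ ir).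
have := narcs_del sr ir rab; have := ncomp_del sr rab; rewrite {}cd; lia.
Qed.

Definition cedges (T : finType) (s : seq T) : {set {set T}} :=
  [set [set a; next s a] | a in s].

Lemma del_cycle (T : finType) (r : rel T) s x y : uniq s ->
  cycle r s -> [set x; y] \notin cedges s -> cycle (del r x y) s.
Proof.
move=> us cs ns; apply: cycle_from_next => // a sa.
rewrite /del (next_cycle cs sa); apply: contraNneq ns => <-; exact: imset_f.
Qed.

(** An edge of [s] outside [s'] is not a bridge, and [s'] survives its deletion, so each of the two
    cycles adds 2 to the doubled cyclomatic number. *)
Lemma leq_ncomp_cycle2 (T : finType) (r : rel T) s s' :
  symmetric r -> irreflexive r ->
  uniq s -> 2 < size s -> cycle r s -> uniq s' -> 2 < size s' -> cycle r s' ->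
  ~~ (cedges s \subset cedges s') -> 2 * #|T| + 4 <= 2 * ncomp r + narcs r.
Proof.
move=> sr ir us ss cs us' ss' cs' /subsetPn[_ /imsetP[a sa ->] ns'].
have rab : r a (next s a) by exact: next_cycle.
have cd := cycle_connect_del us ss sr cs sa.
have cs'' := del_cycle us' cs' ns'.
have := leq_ncomp_cycle (del_sym a (next s a) sr) (del_irr _ _ ir) us' ss' cs''.
have := narcs_del sr ir rab; have := ncomp_del sr rab; rewrite cd; lia.
Qed.

(** * Cycles as vertex sequences *)

Lemma index_next (T : eqType) (s : seq T) (x : T) : uniq s -> x \in s ->
  index (next s x) s = (index x s).+1 %% size s.
Proof.
move=> us xs; rewrite next_nth xs; case: s us xs => // y s us xs.
have := xs; rewrite -index_mem [size _]/= ltnS leq_eqVlt => /orP[/eqP E|lt].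
  by rewrite E nth_default // modnn /= eqxx.
have -> : nth y s (index x (y :: s)) = nth y (y :: s) (index x (y :: s)).+1 by [].
by rewrite index_uniq // modn_small.
Qed.

Lemma next_mono (T : eqType) (s : seq T) (x y : T) : uniq s -> x \in s -> y \in s ->
  (next s x == y) = ((index x s).+1 %% size s == index y s).
Proof.
move=> us xs ys; rewrite -index_next //; apply/eqP/eqP=> [->//|].
by apply: (index_inj x); rewrite ?mem_next.
Qed.

Lemma mem_cedges (T : finType) (s : seq T) (a b : T) :
  ([set a; b] \in cedges s) = (a \in s) && (next s a == b) || (b \in s) && (next s b == a).
Proof.
apply/imsetP/orP => [[c cs /eqP]|[]/andP[xs /eqP E]].
- rewrite eq_set2 => /orP[]/andP[/eqP-> /eqP->]; [left|right]; by rewrite cs eqxx.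
- by exists a; rewrite ?E.
- by exists b; rewrite ?E // setUC.
Qed.

Lemma ord_cycle (k : nat) (i : 'I_k) : next (enum 'I_k) i = ordS i.
Proof.
apply/eqP; rewrite next_mono ?enum_uniq ?mem_enum //.
by rewrite !index_enum_ord size_enum_ord.
Qed.

(** With its converse [is_cycleP], this exchanges cycle subgraphs, defined by an isomorphism with
    [cycle_graph], for duplicate-free vertex sequences. *)
Lemma cycle_subgraph (G : sgraph) (s : seq G) : uniq s -> 2 < size s -> cycle (@adj G) s ->
  exists C : subgraph G, [/\ is_cycle (sub_sgraph C), sub_vertices C = [set x in s]
    & sub_edges C = cedges s].
Proof.
move=> us ss cs.
have sS : is_subgraph (G := G) ([set x in s], cedges s).
  apply/andP; split=> /=.
    by apply/subsetP => _ /imsetP[a sa ->]; rewrite edgesE; exact: next_cycle.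
  apply/forall_inP => _ /imsetP[a sa ->].
  by apply/subsetP => x; rewrite !inE => /orP[]/eqP->; rewrite ?mem_next.
pose C : subgraph G := exist (is_subgraph (G := G)) _ sS; exists C; split=> //.
have cK : #|sub_sgraph C| = size s.
  by rewrite /= card_sig -(card_uniqP us); apply: eq_card => x; rewrite !inE.
rewrite /is_cycle cK ss /=.
have lt (x : sub_sgraph C) : index (val x) s < size s.
  by rewrite index_mem; case: x => x /=; rewrite inE.
apply/isomorphicP; exists (fun x => Ordinal (lt x)).
  apply: inj_card_bij; last by rewrite card_ord cK.
  move=> x y [] /(index_inj (val x)) E; apply/val_inj/E; by rewrite -index_mem lt.
move=> x y; rewrite /= /sub_adj mem_cedges /cycle_adj -!val_eqE /=.
have [xs ys] : (val x \in s) /\ (val y \in s) by rewrite -!index_mem !lt.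
rewrite xs ys !next_mono //=; case: eqVneq => //= <-; rewrite orbb.
move: (lt x); rewrite leq_eqVlt => /orP[/eqP E|h]; last by rewrite modn_small ?gtn_eqF.
by rewrite E modnn; case: (index _ s) E ss => [<-|].
Qed.

Lemma is_cycleP (G : sgraph) (C : subgraph G) : is_cycle (sub_sgraph C) ->
  exists s : seq G, [/\ uniq s, 2 < size s, cycle (@adj G) s &
    sub_vertices C = [set x in s] /\ sub_edges C = cedges s].
Proof.
case/andP=> k2 /isomorphicP[f fb fm]; set k := #|_| in k2 f fb fm *.
have [g fK gK] := fb; pose s := [seq val (g i) | i <- enum 'I_k].
have vg : injective (fun i => val (g i)) by apply: inj_comp val_inj (can_inj gK).
have us : uniq s by rewrite map_inj_uniq ?enum_uniq.
have nxt i : next s (val (g i)) = val (g (ordS i)).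
  by rewrite (next_map vg) ?enum_uniq // ord_cycle.
have mS i : val (g i) \in s by apply/mapP; exists i; rewrite ?mem_enum.
have adS i : sub_adj (g i) (g (ordS i)).
  rewrite -[sub_adj _ _]fm !gK /= /cycle_adj eqxx orTb andbT -val_eqE /=.
  have := ltn_ord i; rewrite leq_eqVlt => /orP[/eqP E|h].
    by rewrite E modnn; apply: contraTneq k2 => i0; rewrite -leqNgt -E i0.
  by rewrite modn_small // neq_ltn ltnSn.
have sE : sub_edges C \subset edges G by case/andP: (valP C).
have sV : forall e, e \in sub_edges C -> e \subset sub_vertices C.
  by case/andP: (valP C) => _ /forall_inP.
exists s; split=> //; first by rewrite size_map size_enum_ord.
  apply: cycle_from_next => // _ /mapP[i _ ->]; rewrite nxt -edgesE.
  exact: (subsetP sE) (adS i).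
split; apply/setP => e; rewrite ?inE.
  apply/idP/mapP => [eV|[i _ ->]]; last exact: (valP (g i)).
  by exists (f (exist _ e eV)); rewrite ?mem_enum // fK.
apply/idP/imsetP => [eC|[_ /mapP[i _ ->] ->]]; last by rewrite nxt; exact: adS.
have := subsetP sE _ eC; rewrite inE => /existsP[x /existsP[y /andP[_ /eqP E]]].
have := sV _ eC; rewrite E subUset !sub1set => /andP[xV yV].
pose x' : sub_sgraph C := exist _ x xV; pose y' : sub_sgraph C := exist _ y yV.
have : @adj (sub_sgraph C) x' y' by rewrite /= /sub_adj /= -E.
have Ex : val (g (f x')) = x by rewrite fK.
have Ey : val (g (f y')) = y by rewrite fK.
rewrite -fm /= /cycle_adj => /andP[_ /orP[]/eqP F].
  exists x; first by rewrite -Ex mS.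
  by rewrite -{3}Ex nxt F Ey.
exists y; first by rewrite -Ey mS.
by rewrite -{3}Ey nxt F Ex setUC.
Qed.

Lemma girth_gt_cycle (G : sgraph) m (s : seq G) : girth_gt G m ->
  uniq s -> 2 < size s -> cycle (@adj G) s -> m < size s.
Proof.
move=> + us ss cs; have [C [cC vC _]] := cycle_subgraph us ss cs.
rewrite /girth_gt /girth; case: pickP => [C0 c0|/(_ C)]; last by rewrite cC.
case: arg_minnP => // D cD /(_ C cC) + lt; rewrite vC.
have -> : #|[set x in s]| = size s by rewrite cardsE; exact/card_uniqP.
exact: leq_trans.
Qed.

(** * Unicyclic components *)

Lemma ncomp_connected (G : sgraph) : connected G -> ncomp (@adj G) = 1.
Proof.
case/andP=> /card_gt0P[x _] /forallP co; rewrite /ncomp -(cards1 (cclass (@adj G) x)).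
congr #|pred_of_set _|; apply/setP => A; rewrite inE; apply/imsetP/eqP => [[y _ ->]|->].
  by apply/eqP; rewrite connect_class; [exact: (forallP (co y)) | exact: adj_sym].
by exists x.
Qed.

Lemma connected_acyclic (G : sgraph) : connected G -> narcs (@adj G) < 2 * #|G| ->
  acyclic (@adj G).
Proof.
move=> co lt s us ss cs.
have := leq_ncomp_cycle (@adj_sym G) (@adj_irrefl G) us ss cs.
rewrite ncomp_connected //; lia.
Qed.

(** The cyclomatic number is 1, so there is a cycle and the edge sets of any two cycles contain each
    other. The vertices of a cycle are the union of its edges, so the two subgraphs coincide. *)
Lemma connected_unicyclic (G : sgraph) : connected G -> narcs (@adj G) = 2 * #|G| ->
  unicyclic G.
Proof.
move=> co E; rewrite /unicyclic co /=.
have [C cC] : exists C : subgraph G, is_cycle (sub_sgraph C).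
  case: (pickP (fun C : subgraph G => is_cycle (sub_sgraph C))) => [C cC|nC].
    by exists C.
  have /(ncomp_narcs_acyclic (@adj_sym G) (@adj_irrefl G)) : acyclic (@adj G).
    by move=> s us ss cs; have [C [cC _ _]] := cycle_subgraph us ss cs; rewrite nC in cC.
  rewrite ncomp_connected //; lia.
rewrite (_ : [set D | _] = [set C]) ?cards1 //; apply/setP => D; rewrite !inE.
apply/idP/eqP => [cD|->//].
have sub (C1 C2 : subgraph G) : is_cycle (sub_sgraph C1) -> is_cycle (sub_sgraph C2) ->
    sub_edges C1 \subset sub_edges C2.
  move=> /is_cycleP[s1 [u1 s1s c1 [_ ->]]] /is_cycleP[s2 [u2 s2s c2 [_ ->]]].
  apply/negPn/negP => /(leq_ncomp_cycle2 (@adj_sym G) (@adj_irrefl G) u1 s1s c1 u2 s2s c2).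
  rewrite ncomp_connected //; lia.
have eE : sub_edges D = sub_edges C by apply/eqP; rewrite eqEsubset !sub.
have vE (C1 : subgraph G) : is_cycle (sub_sgraph C1) ->
    sub_vertices C1 = \bigcup_(e in sub_edges C1) e.
  move=> /is_cycleP[s1 [u1 s1s c1 [-> ->]]]; apply/setP => x; rewrite inE.
  apply/idP/bigcupP => [xs|[_ /imsetP[a sa ->]]].
    by exists [set x; next s1 x]; [exact: imset_f | rewrite set21].
  by rewrite !inE => /orP[]/eqP->; rewrite ?mem_next.
apply: val_inj; have : sub_vertices D = sub_vertices C by rewrite vE // eE -vE.
move: eE; rewrite /sub_edges /sub_vertices; by case: (val D) (val C) => [? ?] [? ?] /= -> ->.
Qed.

Lemma unicyclic_cedges (G : sgraph) (s1 s2 : seq G) : unicyclic G ->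
  uniq s1 -> 2 < size s1 -> cycle (@adj G) s1 ->
  uniq s2 -> 2 < size s2 -> cycle (@adj G) s2 -> cedges s1 = cedges s2.
Proof.
case/andP=> _ /cards1P[C EC] u1 z1 c1 u2 z2 c2.
have [C1 [k1 _ <-]] := cycle_subgraph u1 z1 c1.
have [C2 [k2 _ <-]] := cycle_subgraph u2 z2 c2.
have uC D : is_cycle (sub_sgraph D) -> D = C.
  by move=> cD; apply/set1P; rewrite -EC inE.
by rewrite (uC _ k1) (uC _ k2).
Qed.

Lemma unicyclic_has_cycle (G : sgraph) : unicyclic G ->
  exists s : seq G, [/\ uniq s, 2 < size s & cycle (@adj G) s].
Proof.
case/andP=> _ /cards1P[C EC].
have : C \in [set C] by rewrite inE.
by rewrite -EC inE => /is_cycleP[s [us ss cs _]]; exists s.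
Qed.

(** Deleting an edge of the only cycle leaves a forest. *)
Lemma unicyclic_narcs (G : sgraph) : unicyclic G -> narcs (@adj G) <= 2 * #|G|.
Proof.
move=> uG; have [s [us ss cs]] := unicyclic_has_cycle uG.
have [a sa] : exists a, a \in s by case: s ss {us cs} => // a s; exists a; rewrite mem_head.
pose b := next s a; have rab : adj a b by exact: next_cycle.
have ac : acyclic (del (@adj G) a b).
  move=> t ut st ct; have cta : cycle (@adj G) t by apply: sub_cycle ct; exact: sub_del.
  have : [set a; b] \in cedges s by exact: imset_f.
  rewrite (unicyclic_cedges uG us ss cs ut st cta) => /imsetP[c ct' E].
  by have := next_cycle ct ct'; rewrite /del -E eqxx andbF.
have := ncomp_narcs_acyclic (del_sym a b (@adj_sym G)) (del_irr _ _ (@adj_irrefl G)) ac.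
have := narcs_del (@adj_sym G) (@adj_irrefl G) rab.
have : 0 < ncomp (del (@adj G) a b).
  by apply/card_gt0P; exists (cclass (del (@adj G) a b) a); apply: imset_f.
lia.
Qed.

Lemma component_mem (G : sgraph) (x : G) (z : component x) : connect (@adj G) x (val z).
Proof. by case: z => z /=; rewrite /sub_vertices /= inE. Qed.

Lemma component_adj (G : sgraph) (x : G) (z t : component x) :
  adj z t = adj (val z) (val t).
Proof.
rewrite /= /sub_adj /sub_edges /= inE edgesE subUset !sub1set !inE.
by rewrite !component_mem !andbT.
Qed.

Lemma component_seq (G : sgraph) (x : G) (s : seq G) : {subset s <= connect (@adj G) x} ->
  exists s' : seq (component x), s = map val s'.
Proof.
move=> sub; have /all_sigP[s' ->] : all (mem (sub_vertices (induced (cclass (@adj G) x)))) s.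
  by apply/allP => y /sub ys; rewrite /= /sub_vertices /= inE.
by exists s'.
Qed.

Lemma component_cycle (G : sgraph) (x : G) (s : seq G) :
  uniq s -> cycle (@adj G) s -> {subset s <= connect (@adj G) x} ->
  exists s' : seq (component x),
    [/\ s = map val s', uniq s' & cycle (@adj (component x)) s'].
Proof.
move=> us cs /component_seq[s' E]; exists s'; split=> //.
  by rewrite -(map_inj_uniq val_inj) -E.
by move: cs; rewrite E (mono_cycle (e := @adj (component x))) // => z t; rewrite component_adj.
Qed.

Lemma cycle_subset_connect (T : finType) (r : rel T) (s : seq T) (x : T) :
  cycle r s -> x \in s -> {subset s <= connect r x}.
Proof.
move=> cs xs; have [i t E] := rot_to xs => y.
rewrite -(mem_rot i) E; have : cycle r (x :: t) by rewrite -E rot_cycle.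
rewrite /= rcons_path inE => /andP[pt _] /orP[/eqP->|yt]; first exact: connect0.
by apply: path_connect pt _ _; rewrite inE yt orbT.
Qed.

Lemma component_connected (G : sgraph) (x : G) : connected (component x).
Proof.
have xV : x \in sub_vertices (induced (cclass (@adj G) x)).
  by rewrite /sub_vertices /= inE connect0.
pose x' : component x := exist _ x xV.
have cx (y : component x) : connect (@adj (component x)) x' y.
  have /connectP[p pp lp] := component_mem y.
  have sub : {subset x :: p <= connect (@adj G) x} by move=> z; exact: path_connect pp _.
  have [[//|z s'] E] := component_seq sub.
  have zx : z = x' by apply: val_inj; case: E.
  case: E => _ Ep; apply/connectP; exists s'.
    have: path (@adj G) (val x') (map val s') by rewrite -Ep.
    by rewrite (mono_path (e := @adj (component x))) // => u v; rewrite component_adj.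
  by apply: val_inj; rewrite -last_map -Ep.
have sc := sym_connect_sym (@adj_sym (component x)).
apply/andP; split; first by apply/card_gt0P; exists x'.
by apply/forallP => y; apply/forallP => z; apply: connect_trans (cx z); rewrite sc.
Qed.

Lemma card_component (G : sgraph) (x : G) : #|component x| = #|cclass (@adj G) x|.
Proof. by rewrite /= card_sig; apply: eq_card => y; rewrite !inE. Qed.

Lemma narcs_component (G : sgraph) (x : G) : narcs (@adj (component x)) =
  #|[set p : G * G | adj p.1 p.2 & cclass (@adj G) p.1 == cclass (@adj G) x]|.
Proof.
have sc := sym_connect_sym (@adj_sym G).
rewrite /narcs -(card_imset _ (f := fun p => (val p.1, val p.2))); last first.
  by move=> [a b] [c d] [/val_inj-> /val_inj->].
apply: eq_card => -[a b]; rewrite !inE /= (connect_class _ _ (@adj_sym G)) sc.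
apply/imsetP/andP => [[[u v]]|[ab xa]].
  rewrite inE => uv [-> ->]; rewrite component_mem; split=> //.
  by rewrite -(component_adj u v).
have xb : connect (@adj G) x b by exact: connect_trans xa (connect1 ab).
have aV : a \in sub_vertices (induced (cclass (@adj G) x)) by rewrite /sub_vertices /= inE.
have bV : b \in sub_vertices (induced (cclass (@adj G) x)) by rewrite /sub_vertices /= inE.
pose a' : component x := exist _ a aV; pose b' : component x := exist _ b bV.
by exists (a', b'); rewrite // inE; have := component_adj a' b' => /= ->.
Qed.

Lemma sum_component (G : sgraph) : narcs (@adj G) =
  \sum_(A in [set cclass (@adj G) x | x : G])
    #|[set p : G * G | adj p.1 p.2 & cclass (@adj G) p.1 == A]|.
Proof.
rewrite /narcs -sum1_card (partition_big (fun p : G * G => cclass (@adj G) p.1)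
  (mem [set cclass (@adj G) x | x : G])) => [|p _]; last exact: imset_f.
by apply: eq_bigr => A _; rewrite -sum1_card; apply: eq_bigl => p; rewrite !inE.
Qed.

Lemma sum_card_component (G : sgraph) : #|G| =
  \sum_(A in [set cclass (@adj G) x | x : G]) #|[set y | cclass (@adj G) y == A]|.
Proof.
rewrite -sum1_card (partition_big (fun p : G => cclass (@adj G) p)
  (mem [set cclass (@adj G) x | x : G])) => [|p _]; last exact: imset_f.
by apply: eq_bigr => A _; rewrite -sum1_card; apply: eq_bigl => p; rewrite !inE.
Qed.

Lemma card_cclass (G : sgraph) (x : G) :
  #|[set y | cclass (@adj G) y == cclass (@adj G) x]| = #|component x|.
Proof.
rewrite card_component; apply: eq_card => y.
rewrite !inE connect_class; last exact: adj_sym.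
exact: sym_connect_sym (@adj_sym G) y x.
Qed.

Lemma leq_narcs_components (G : sgraph) :
  (forall x : G, narcs (@adj (component x)) <= 2 * #|component x|) ->
  narcs (@adj G) <= 2 * #|G|.
Proof.
move=> le; rewrite sum_component sum_card_component big_distrr /=.
by apply: leq_sum => _ /imsetP[x _ ->]; rewrite -narcs_component card_cclass.
Qed.

(** Both quantities are sums over the components. The inequality of the totals is opposite to the
    inequalities of the terms, so [leqif_sum] forces equality term by term. *)
Lemma geq_narcs_components (G : sgraph) (x : G) : narcs (@adj G) <= 2 * #|G| ->
  (forall x : G, 2 * #|component x| <= narcs (@adj (component x))) ->
  narcs (@adj (component x)) = 2 * #|component x|.
Proof.
rewrite sum_component sum_card_component big_distrr /= => le ge.
set P := [set _ | _ in _] in le.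
have ge' A : A \in P -> 2 * #|[set y | cclass (@adj G) y == A]| <=
    #|[set p : G * G | adj p.1 p.2 & cclass (@adj G) p.1 == A]| ?= iff
    (2 * #|[set y | cclass (@adj G) y == A]| ==
     #|[set p : G * G | adj p.1 p.2 & cclass (@adj G) p.1 == A]|).
  by case/imsetP=> y _ ->; apply: leqif_eq; rewrite -narcs_component card_cclass; exact: ge.
have [le'] := leqif_sum ge'; rewrite eqn_leq le' le => /esym/forall_inP eqA.
by apply/esym/eqP; rewrite narcs_component -card_cclass; apply: eqA; exact: imset_f.
Qed.

(** Both cycles lie in the component of [v], where the cycle is unique; the work is to carry edges
    to the vertex type of that component and back. *)
Lemma components_cedges (G : sgraph) (s1 s2 : seq G) (v a b : G) :
  all_components_unicyclic G ->
  uniq s1 -> 2 < size s1 -> cycle (@adj G) s1 -> v \in s1 ->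
  uniq s2 -> 2 < size s2 -> cycle (@adj G) s2 -> v \in s2 ->
  [set a; b] \in cedges s1 -> [set a; b] \in cedges s2.
Proof.
move=> uG u1 z1 c1 v1 u2 z2 c2 v2.
have [t1 [E1 w1 d1]] := component_cycle u1 c1 (cycle_subset_connect c1 v1).
have [t2 [E2 w2 d2]] := component_cycle u2 c2 (cycle_subset_connect c2 v2).
move: z1 z2; rewrite {}E1 {}E2 !size_map => z1 z2.
have cE := unicyclic_cedges (uG v) w1 z1 d1 w2 z2 d2.
case/imsetP=> _ /mapP[u ut ->]; rewrite (next_map val_inj) // => ->.
have : [set u; next t1 u] \in cedges t1 by exact: imset_f.
rewrite cE => /imsetP[z zt /eqP]; rewrite eq_set2 => /orP[]/andP[/eqP-> /eqP->].
  apply/imsetP; exists (val z); first by apply/mapP; exists z.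
  by rewrite (next_map val_inj).
apply/imsetP; exists (val z); first by apply/mapP; exists z.
by rewrite (next_map val_inj) // setUC.
Qed.

(** The cycle in the component of [v] supplies a second vertex there. A vertex of degree 0 would
    spoil the bound [deg v - 1] for the edges of its link. *)
Lemma components_deg (G : sgraph) (v : G) : all_components_unicyclic G -> exists w, adj v w.
Proof.
move=> /(_ v) uv; have [s [us ss _]] := unicyclic_has_cycle uv.
have [z zv] : exists z : component v, val z != v.
  case: s us ss => [|a [|b s]] //= /andP[]; rewrite inE negb_or => /andP[ab _] _ _.
  case: (eqVneq (val a) v) => [av|]; last by exists a.
  by exists b; apply: contraNneq ab => bv; apply/eqP/val_inj; exact: etrans av (esym bv).
have /connectP[[|w p] /=] := component_mem z; first by move=> _ E; case/eqP: zv.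
by case/andP=> vw _ _; exists w.
Qed.

(** * Pairs of arms *)

Definition arm (G : sgraph) (v : G) (p : seq G) := uniq (v :: p) && path (@adj G) v p.

(* [vx] and [vy] are consecutive edges of a [P_n] with middle vertex [v], given by its two
   arms [x :: p] and [y :: q] starting at [v]. *)
Definition paired (n : nat) (G : sgraph) (v x y : G) := exists p q,
  [/\ uniq (v :: (x :: p) ++ y :: q), path (@adj G) v (x :: p),
      path (@adj G) v (y :: q) & size p + size q + 3 = n].

Lemma paired_sym n (G : sgraph) (v x y : G) : paired n v x y -> paired n v y x.
Proof.
case=> p [q [u px py sz]]; exists q, p; split=> //; last by lia.
by rewrite (perm_uniq (_ : perm_eq _ (v :: (x :: p) ++ y :: q))) // perm_cons perm_catC.
Qed.

(** A path that is too long is trimmed at its ends to exactly [n] vertices; since [3 <= n], the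
    edges [vx] and [vy] can be kept. *)
Lemma paired_leq n (G : sgraph) (v x y : G) p q : 3 <= n ->
  uniq (v :: (x :: p) ++ y :: q) -> path (@adj G) v (x :: p) -> path (@adj G) v (y :: q) ->
  n <= size p + size q + 3 -> paired n v x y.
Proof.
move=> n3 u px py sz; have [i [j [ip jq ijn]]] : exists i j,
    [/\ i <= size p, j <= size q & i + j + 3 = n].
  exists (minn (size p) (n - 3)), (n - 3 - minn (size p) (n - 3)); split; lia.
exists (take i p), (take j q).
have tp (s : seq G) k z : path (@adj G) z s -> path (@adj G) z (take k s).
  by rewrite -{1}(cat_take_drop k s) cat_path => /andP[].
split; last by rewrite !size_takel.
- apply: (subseq_uniq _ u); rewrite -cat_cons -[v :: _ ++ _]cat_cons.
  by apply: cat_subseq => /=; rewrite !eqxx take_subseq.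
- by case/andP: px => /= -> /tp->.
- by case/andP: py => /= -> /tp->.
Qed.

Lemma path_subgraph (G : sgraph) (s : seq G) : uniq s -> sorted (@adj G) s ->
  exists2 S : subgraph G, isomorphic (sub_sgraph S) (path_graph (size s)) &
    forall a b, a \in s -> b \in s -> (index a s).+1 = index b s ->
      [set a; b] \in sub_edges S.
Proof.
move=> us ss.
have adS a b : a \in s -> b \in s -> (index a s).+1 = index b s -> adj a b.
  move=> sa sb E; have := (elimT (sortedP a) ss) (index a s).
  by rewrite E index_mem !nth_index // => ->.
pose F := [set e : {set G} | [exists a, exists b,
  [&& a \in s, b \in s, (index a s).+1 == index b s & e == [set a; b]]]].
have FP e : e \in F -> exists a b,
    [/\ a \in s, b \in s, (index a s).+1 = index b s & e = [set a; b]].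
  rewrite inE => /existsP[a /existsP[b /and4P[sa sb /eqP E /eqP ->]]].
  by exists a, b.
have sS : is_subgraph (G := G) ([set x in s], F).
  apply/andP; split.
    by apply/subsetP => _ /FP[a [b [sa sb E ->]]]; rewrite edgesE adS.
  apply/forall_inP => _ /FP[a [b [sa sb E ->]]].
  by apply/subsetP => c; rewrite !inE => /orP[]/eqP->.
have Fin a b : a \in s -> b \in s -> (index a s).+1 = index b s -> [set a; b] \in F.
  move=> sa sb E; rewrite inE; apply/existsP; exists a; apply/existsP; exists b.
  by rewrite sa sb E !eqxx.
exists (exist (is_subgraph (G := G)) _ sS) => //.
set S := exist _ _ _.
have cK : #|sub_sgraph S| = size s.
  by rewrite /= card_sig -(card_uniqP us); apply: eq_card => x; rewrite !inE.
have ms (x : sub_sgraph S) : val x \in s by case: x => x /=; rewrite inE.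
have lt (x : sub_sgraph S) : index (val x) s < size s by rewrite index_mem.
apply/isomorphicP; exists (fun x => Ordinal (lt x)).
  apply: inj_card_bij; last by rewrite card_ord cK.
  by move=> x y [] /(index_inj (val x)) E; apply/val_inj/E; rewrite ms.
move=> x y; have xs := ms x; have ys := ms y.
rewrite /= /sub_adj /path_adj /=; apply/idP/idP.
  by case/orP=> /eqP E; [|rewrite setUC]; apply: Fin.
case/FP=> a [b [_ _ E /eqP]]; rewrite eq_set2.
by case/orP=> /andP[/eqP-> /eqP->]; rewrite E eqxx ?orbT.
Qed.

Lemma sorted_catrev (T : Type) (e : rel T) (v : T) (p q : seq T) : symmetric e ->
  path e v p -> path e v q -> sorted e (catrev p (v :: q)).
Proof.
move=> se; elim: p v q => //= a p IH v q /andP[va pa] vq.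
by apply: IH => //=; rewrite se va.
Qed.

(** Reversing the arm [x :: p] and appending [v :: y :: q] gives the vertex sequence of the
    [P_n]. *)
Lemma paired_path_adjacent n (G : sgraph) (v x y : G) :
  paired n v x y -> path_adjacent n [set v; x] [set v; y].
Proof.
case=> p [q [u px py sz]]; have ss := sorted_catrev (@adj_sym G) px py.
rewrite [catrev _ _]/= catrevE in ss; set s := rev p ++ [:: x, v, y & q] in ss.
have us : uniq s.
  rewrite -(perm_uniq (_ : perm_eq (v :: (x :: p) ++ y :: q) s)) //.
  by apply/permP => P; rewrite /= !count_cat count_rev /=; lia.
have [S iS eS] := path_subgraph us ss.
have szs : size s = n by rewrite size_cat size_rev /=; lia.
move: (us); rewrite cat_uniq => /and3P[_ nh]; rewrite /= !inE !negb_or.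
case/and4P=> /and3P[xv xy xq] /andP[vy vq] yq _.
have nr z : z \in [:: x, v, y & q] -> index z s = size p + index z [:: x, v, y & q].
  move=> zq; rewrite index_cat size_rev ifN //.
  by apply: contra nh => zp; apply/hasP; exists z.
have sx : index x s = size p by rewrite nr ?inE ?eqxx //= eqxx addn0.
have sv : index v s = (size p).+1 by rewrite nr ?inE ?eqxx ?orbT //= (negPf xv) eqxx addn1.
have sy : index y s = (size p).+2.
  by rewrite nr ?inE ?eqxx ?orbT //= (negPf xy) (negPf vy) eqxx addn2.
have m z : z \in [:: x; v; y] -> z \in s.
  by rewrite mem_cat !inE => /or3P[]->; rewrite ?orbT.
apply/and3P; split.
- by rewrite eq_set2 eqxx (negPf xy) /= negb_and vy.
- by apply/set0Pn; exists v; rewrite !inE eqxx.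
- apply/existsP; exists S; rewrite -szs iS /=; apply/andP; split.
    by rewrite setUC; apply: eS; rewrite ?m ?inE ?eqxx ?orbT // sx.
  by apply: eS; rewrite ?m ?inE ?eqxx ?orbT // sv.
Qed.

Lemma path_adjacent_paired n (G : sgraph) (v x y : G) :
  path_adjacent n [set v; x] [set v; y] -> paired n v x y.
Proof.
case/and3P=> exy _ /existsP[S /and3P[/isomorphicP[f fb fm] e1 e2]].
have [g fK gK] := fb.
have sV : forall e, e \in sub_edges S -> e \subset sub_vertices S.
  by case/andP: (valP S) => _ /forall_inP.
have := sV _ e1; have := sV _ e2; rewrite !subUset !sub1set.
case/andP=> vV yV /andP[_ xV].
have adS (z t : sub_sgraph S) : adj z t -> adj (val z) (val t).
  by move=> zt; rewrite -edgesE; case/andP: (valP S) => /subsetP + _; apply.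
pose v' : sub_sgraph S := exist _ v vV.
pose x' : sub_sgraph S := exist _ x xV; pose y' : sub_sgraph S := exist _ y yV.
have vx : adj (f v') (f x') by rewrite fm.
have vy : adj (f v') (f y') by rewrite fm.
have nxy : f x' != f y'.
  by apply: contraNneq exy => /(bij_inj fb)/(congr1 val) /= ->.
(* [h] lists the vertices of the [P_n] by natural numbers. The default value of [insubd] is returned
   only for [k >= n], where [h] is never evaluated. *)
pose h k := val (g (insubd (f v') k)).
have hf z : h (f z) = val z by rewrite /h (_ : insubd _ _ = f z) ?fK //; exact: valKd.
have hA k : k.+1 < n -> adj (h k) (h k.+1).
  move=> lt; apply: adS; rewrite -fm !gK /= /path_adj !val_insubd lt (ltnW lt).
  by rewrite eqxx.
have hI : {in gtn n &, injective h}.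
  move=> k l; rewrite !inE => kn ln /val_inj/(can_inj gK)/(congr1 val).
  by rewrite !val_insubd kn ln.
have up k m : k + m < n -> path (@adj G) (h k) (map h (iota k.+1 m)).
  elim: m k => //= m IH k lt; rewrite hA ?IH //; lia.
have dn k : k < n -> path (@adj G) (h k) (map h (rev (iota 0 k))).
  elim: k => // k IH lt; rewrite -addn1 iotaD add0n rev_cat /= addn1 adj_sym hA //=.
  by apply: IH; lia.
(* The neighbours of [v] on the path sit just before and just after it. This treats one orientation;
   [paired_sym] gives the other. *)
have key (a b : sub_sgraph S) : (f a).+1 = f v' -> (f v').+1 = f b ->
    paired n v (val a) (val b).
  move=> Ea Eb; set i := nat_of_ord (f v') in Ea Eb.
  have bn : i.+1 < n by rewrite Eb.
  have hi : h i = v by exact: (hf v').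
  have E1 : map h (rev (iota 0 i)) = val a :: map h (rev (iota 0 (f a))).
    by rewrite -Ea -addn1 iotaD add0n rev_cat /= hf.
  have E2 : map h (iota i.+1 (n - i.+1)) = val b :: map h (iota i.+2 (n - i.+2)).
    by rewrite -(hf b) -Eb -[n - i.+1]prednK ?subn_gt0 //= -subnS.
  exists (map h (rev (iota 0 (f a)))), (map h (iota i.+2 (n - i.+2))); split.
  - rewrite -E1 -E2 -map_cat -{1}hi -map_cons map_inj_in_uniq.
      rewrite (perm_uniq (_ : perm_eq _ (iota 0 i ++ i :: iota i.+1 (n - i.+1)))).
        rewrite (_ : i :: _ = iota i (n - i)); last first.
          by rewrite -[n - i]prednK ?subn_gt0 ?(ltnW bn) //= -subnS.
        by rewrite -{2}[i]add0n -iotaD iota_uniq.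
      by apply/permP => P; rewrite /= !count_cat count_rev /=; lia.
    by move=> k l Hk Hl; apply: hI; rewrite !inE; move: Hk Hl;
      rewrite !inE !mem_cat !mem_rev !mem_iota; lia.
  - by rewrite -E1 -hi dn // ltnW.
  - by rewrite -E2 -hi up //; lia.
  - by rewrite !size_map size_rev !size_iota; lia.
move: vx vy nxy; rewrite /= /path_adj -val_eqE /=.
case/orP=> /eqP A /orP[]/eqP B N.
- by rewrite -A -B eqxx in N.
- exact/paired_sym/(key y' x').
- exact: (key x' y').
- by move: A; rewrite -B => -[A]; rewrite A eqxx in N.
Qed.

(** * Links of vertices *)

Definition nbrs (G : sgraph) (v : G) := [set x | adj v x].

Lemma narcs_sum (T : finType) (r : rel T) : narcs r = \sum_v #|[set x | r v x]|.
Proof.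
rewrite /narcs -sum1_card (eq_bigr (fun v => \sum_(x | r v x) 1)).
  by rewrite (pair_big_dep predT r) /=; apply: eq_bigl => p; rewrite inE.
by move=> v _; rewrite -sum1_card; apply: eq_bigl => x; rewrite inE.
Qed.

Lemma edgesP (G : sgraph) (e : {set G}) :
  reflect (exists x y, adj x y /\ e = [set x; y]) (e \in edges G).
Proof.
rewrite inE; apply: (iffP existsP) => [[x /existsP[y /andP[xy /eqP ->]]]|[x [y [xy ->]]]].
  by exists x, y.
by exists x; apply/existsP; exists y; rewrite xy eqxx.
Qed.

Lemma edges_at (G : sgraph) (e : {set G}) (v : G) : e \in edges G -> v \in e ->
  exists2 x, adj v x & e = [set v; x].
Proof.
case/edgesP=> x [y [xy ->]]; rewrite !inE => /orP[]/eqP->; first by exists y.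
by exists x; [rewrite adj_sym | rewrite setUC].
Qed.

Lemma card_HL n (G : sgraph) : #|HL n G| = #|edges G|.
Proof. by rewrite /= card_sig; apply: eq_card => e; rewrite !inE. Qed.

Lemma narcs_edges (G : sgraph) : narcs (@adj G) = 2 * #|edges G|.
Proof.
rewrite /narcs -sum1_card (partition_big (fun p : G * G => [set p.1; p.2])
  (mem (edges G))) => [|[x y]]; last by rewrite /= inE edgesE.
rewrite mulnC -sum_nat_const; apply: eq_bigr => e /edgesP[x [y [xy ->]]].
rewrite sum1_card -(_ : #|[set (x, y); (y, x)]| = 2); last first.
  by rewrite cards2 xpair_eqE (negPf (adj_neq xy)).
apply: eq_card => -[a b]; rewrite [LHS]unfold_in /= !inE /= eq_set2 !xpair_eqE.
by apply: andb_idl => /orP[]/andP[/eqP-> /eqP->] //; rewrite adj_sym.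
Qed.

(* The [HL]-adjacencies created at [v], with the edge [vx] represented by [x]; the
   non-neighbours of [v] are isolated. *)
Definition link n (G : sgraph) (v : G) : rel G :=
  fun x y => [&& adj v x, adj v y & path_adjacent n [set v; x] [set v; y]].

Lemma link_neq n (G : sgraph) (v x y : G) : link n v x y -> x != y.
Proof. by case/and3P=> _ _ /and3P[+ _ _]; apply: contraNneq => ->. Qed.

Lemma link_irr n (G : sgraph) (v : G) : irreflexive (link n v).
Proof. by move=> x; apply/negP => /link_neq; rewrite eqxx. Qed.

Lemma link_sym n (G : sgraph) (v : G) : symmetric (link n v).
Proof.
move=> x y; rewrite /link andbCA; congr [&& _, _ & _].
rewrite /path_adjacent eq_sym setIC; congr [&& _, _ & _].
by apply: eq_existsb => S; congr andb; rewrite andbC.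
Qed.

Lemma linkP n (G : sgraph) (v x y : G) : link n v x y <-> paired n v x y.
Proof.
split=> [/and3P[_ _ /path_adjacent_paired]|pvxy] //.
apply/and3P; rewrite (paired_path_adjacent pvxy).
by case: pvxy => p [q [_ /= /andP[-> _] /andP[-> _] _]].
Qed.

Lemma path_adjacent_link n (G : sgraph) (e1 e2 : {set G}) :
  e1 \in edges G -> e2 \in edges G -> path_adjacent n e1 e2 ->
  exists v x y, [/\ e1 = [set v; x], e2 = [set v; y] & link n v x y].
Proof.
move=> E1 E2 adj12; have /and3P[_ /set0Pn[v] + _] := adj12.
rewrite inE => /andP[/(edges_at E1)[x vx F1] /(edges_at E2)[y vy F2]].
by exists v, x, y; split=> //; rewrite /link vx vy -F1 -F2.
Qed.

(** Two distinct edges of a simple graph share at most one vertex, so each adjacency of [HL n G]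
    belongs to exactly one link. *)
Lemma narcs_HL n (G : sgraph) : narcs (@adj (HL n G)) = \sum_v narcs (link n v : rel G).
Proof.
transitivity #|[set P : {set G} * {set G} |
    [&& P.1 \in edges G, P.2 \in edges G & path_adjacent n P.1 P.2]]|.
  rewrite /narcs -(card_imset _ (f := fun p => (val p.1, val p.2))); last first.
    by move=> [a b] [c d] [/val_inj-> /val_inj->].
  apply: eq_card => -[a b]; rewrite in_set /=; apply/imsetP/and3P => [[[u v]]|[Ea Eb ab]].
    by rewrite inE => uv [-> ->]; split; [exact: (valP u) | exact: (valP v) | exact: uv].
  by exists (exist _ a Ea : HL n G, exist _ b Eb : HL n G); rewrite // inE.
transitivity #|[set t : G * (G * G) | link n t.1 t.2.1 t.2.2]|.
  rewrite -(card_in_imset (f := fun t : G * (G * G) => ([set t.1; t.2.1], [set t.1; t.2.2]))).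
    apply: eq_card => -[a b]; rewrite in_set /=; apply/and3P/imsetP.
      case=> Ea Eb /(path_adjacent_link Ea Eb)[v [x [y [-> -> l]]]].
      by exists (v, (x, y)); rewrite ?inE.
    by case=> -[v [x y]]; rewrite inE /= => /and3P[vx vy l] [-> ->]; rewrite !edgesE.
  move=> [v [x y]] [w [z t]]; rewrite !inE /= => l1 l2 [/eqP + /eqP].
  have := link_neq l1; have := link_neq l2; rewrite !eq_set2.
  case/and3P: l1 => /adj_neq vx /adj_neq vy _; case/and3P: l2 => /adj_neq wz /adj_neq wt _.
  move=> zt xy /orP[]/andP[/eqP vw /eqP xz] /orP[]/andP[/eqP vw' /eqP xz'];
    by rewrite vw xz xz' // -?vw ?vw' -?xz ?xz' ?eqxx in zt xy vx vy wz wt *.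
rewrite -sum1_card (eq_bigr (fun v => \sum_(p : G * G | link n v p.1 p.2) 1)).
  rewrite (pair_big_dep predT (fun v p => link n v p.1 p.2)) /=.
  by apply: eq_bigl => p; rewrite inE.
by move=> v _; rewrite /narcs -sum1_card; apply: eq_bigl => p; rewrite inE.
Qed.

(** Each non-neighbour of [v] is a class of its own and [w] lies in a further one, so the link has
    at least [#|~: nbrs v| + 1] classes; the forest formula then leaves at most [deg v - 1]
    edges. *)
Lemma acyclic_link_narcs n (G : sgraph) (v w : G) : adj v w -> acyclic (link n v) ->
  narcs (link n v) + 2 <= 2 * #|nbrs v|.
Proof.
move=> vw ac; have := ncomp_narcs_acyclic (@link_sym n G v) (@link_irr n G v) ac.
set r := link n v.
have iso x y : connect r x y -> x \notin nbrs v -> x = y.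
  by case/connectP=> -[|z p] //= /andP[/and3P[vx _ _] _] _; rewrite inE vx.
have : #|w |: ~: nbrs v| <= ncomp r.
  rewrite -(card_in_imset (f := cclass r)).
    by apply: subset_leq_card; apply/subsetP => _ /imsetP[x _ ->]; apply: imset_f.
  move=> x y xD yD /eqP; rewrite connect_class; last exact: link_sym.
  move=> c; have c' : connect r y x by rewrite (sym_connect_sym (@link_sym n G v)).
  move: xD yD; rewrite !in_setU1 !in_setC => /orP[/eqP xw|xN]; last by rewrite (iso _ _ c).
  by case/orP=> [/eqP->//|yN]; rewrite (iso _ _ c').
rewrite cardsU1 !inE vw /= -(cardsC (nbrs v)).
move: (ncomp r) (narcs r) #|nbrs v| #|~: nbrs v|; lia.
Qed.

(** * Lengths of arms *)

Definition away (G : sgraph) (v : G) : rel G :=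
  fun a b => [&& adj a b, a != v & b != v].

Lemma away_sym (G : sgraph) (v : G) : symmetric (away v).
Proof. by move=> a b; rewrite /away adj_sym andbCA andbC -andbA andbC. Qed.

Lemma away_connect_sym (G : sgraph) (v : G) : connect_sym (away v).
Proof. exact/sym_connect_sym/away_sym. Qed.

(** A path from [x] to [y] avoiding [v] is closed through [v]. The description of the cycle's edges
    at [v] lets uniqueness of the cycle be read off at [v] alone. *)
Lemma away_cycle (G : sgraph) (v x y : G) : adj v x -> adj v y -> x != y ->
  connect (away v) x y -> exists s,
  [/\ uniq s, 2 < size s, cycle (@adj G) s, v \in s &
    forall z, ([set v; z] \in cedges s) = (z == x) || (z == y)].
Proof.
move=> vx vy xy /connectP[p pp lp]; case: (shortenP pp) lp => q pq uq _ lq.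
have vq : v \notin x :: q.
  elim: q x pq {uq lq pp xy} vx => [|a q IH] x /=; first by rewrite inE => _ /adj_neq.
  move=> /andP[/and3P[_ xv av] pq] _; rewrite inE negb_or eq_sym xv /=.
  elim: q a av pq {IH} => [|b q IH] a av /=; first by rewrite inE eq_sym.
  by case/andP=> /and3P[_ _ bv] /(IH _ bv) nb; rewrite inE negb_or eq_sym av.
have us : uniq (v :: x :: q) by rewrite [uniq _]/= -/(uniq (x :: q)) vq uq.
exists (v :: x :: q); split=> //.
- by case: q lq {pq uq vq us} => //= lq; rewrite lq eqxx in xy.
- rewrite /= vx rcons_path -lq adj_sym vy andbT.
  by apply: sub_path pq => a b /and3P[].
- exact: mem_head.
have nv : next (v :: x :: q) v = x by rewrite /= eqxx.
have ny : next (v :: x :: q) y = v.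
  have yq : y \in v :: x :: q by rewrite lq inE mem_last orbT.
  by apply/eqP; rewrite next_mono ?mem_head // lq -[x in last x]/(last v [:: x])
    -last_cat index_last //= modnn eqxx.
move=> z; rewrite mem_cedges mem_head nv eq_sym; case: eqVneq => [//|zx].
rewrite !orFb; apply/andP/eqP => [[zs /eqP nz]|->]; last by rewrite ny lq inE mem_last orbT eqxx.
by rewrite -(prev_next us z) nz -[RHS](prev_next us) ny.
Qed.

(* One less than the length of a longest path from [v] whose first edge is [vx]; this is
   the junk value [0] when [x] is not a neighbour of [v]. *)
Definition depth (G : sgraph) (v x : G) : nat :=
  \max_(k < #|G|.+1 | [exists t : k.-tuple G, arm v (x :: t)]) k.

Lemma leq_depth (G : sgraph) (v x : G) p : arm v (x :: p) -> size p <= depth v x.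
Proof.
move=> ap; have lt : size p < #|G|.+1.
  rewrite ltnS; case/andP: ap => /= /and3P[_ _ /card_uniqP <-] _; exact: max_card.
apply: (@leq_bigmax_cond _ _ (fun k : 'I__ => k : nat) (Ordinal lt)) => /=.
by apply/existsP; exists (in_tuple p).
Qed.

Lemma depth_arm (G : sgraph) (v x : G) : adj v x ->
  exists2 p, arm v (x :: p) & size p = depth v x.
Proof.
move=> vx; have [|k] := @eq_bigmax_cond _
    [pred k : 'I_#|G|.+1 | [exists t : k.-tuple G, arm v (x :: t)]] (fun k => k : nat).
  apply/card_gt0P; exists ord0; apply/existsP; exists [tuple].
  by rewrite /arm /= inE vx adj_neq.
by rewrite inE => /existsP[t at_] E; exists t => //; rewrite size_tuple -E.
Qed.

Lemma arm_connect (G : sgraph) (v x z : G) p : arm v (x :: p) -> z \in x :: p ->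
  connect (away v) x z.
Proof.
case/andP=> /andP[nv _] /= /andP[_ pp]; apply: path_connect.
elim: p x pp nv => //= y p IH x /andP[xy pp]; rewrite !inE !negb_or => /and3P[vx vy vp].
by rewrite /away xy eq_sym vx eq_sym vy IH // inE negb_or vy.
Qed.

Lemma link_depth n (G : sgraph) (v x y : G) : link n v x y ->
  n <= depth v x + depth v y + 3.
Proof.
case/linkP=> p [q [u px py <-]].
have [ap aq] : arm v (x :: p) /\ arm v (y :: q).
  move: u; rewrite cons_uniq mem_cat negb_or cat_uniq.
  case/andP=> /andP[vp vq] /and3P[up _ uq].
  by rewrite /arm px py ![uniq (v :: _)]cons_uniq vp vq up uq.
by rewrite !leq_add2r leq_add ?leq_depth.
Qed.

(** Beyond [v], the two arms run in different components of the graph without [v], so they cannot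
    meet. *)
Lemma arm_cat_uniq (G : sgraph) (v x y : G) p q : arm v (x :: p) -> arm v (y :: q) ->
  ~~ connect (away v) x y -> uniq (v :: (x :: p) ++ y :: q).
Proof.
move=> ap aq nxy; have cp := arm_connect ap; have cq := arm_connect aq.
move: ap aq => /andP[/andP[vp up] pp] /andP[/andP[vq uq] pq].
rewrite cons_uniq mem_cat negb_or vp vq cat_uniq.
rewrite [uniq (x :: p)]up [uniq (y :: q)]uq !andTb andbT.
apply: contra nxy => /hasP[z zq zp]; apply: connect_trans (cp _ zp) _.
by rewrite away_connect_sym cq.
Qed.

Lemma depth_link n (G : sgraph) (v x y : G) : 3 <= n -> adj v x -> adj v y ->
  ~~ connect (away v) x y -> n <= depth v x + depth v y + 3 -> link n v x y.
Proof.
move=> n3 /depth_arm[p ap <-] /depth_arm[q aq <-] nxy le.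
have u := arm_cat_uniq ap aq nxy; case/andP: ap => _ pp; case/andP: aq => _ pq.
exact/linkP/(paired_leq n3 u pp pq).
Qed.

(* Away from cycles a link is a threshold graph for [depth], and such graphs have no
   alternating 4-cycle: [d1 + d2] and [d3 + d4] are large, hence [d1 + d3] or [d2 + d4] is. *)
Lemma link_chord n (G : sgraph) (v x1 x2 x3 x4 : G) : 3 <= n ->
  link n v x1 x2 -> link n v x3 x4 ->
  ~~ connect (away v) x1 x3 -> ~~ connect (away v) x2 x4 ->
  link n v x1 x3 || link n v x2 x4.
Proof.
move=> n3 l12 l34 n13 n24; have := link_depth l12; have := link_depth l34.
case/and3P: l12 => v1 v2 _; case/and3P: l34 => v3 v4 _ d34 d12.
have [le|lt] := leqP n (depth v x1 + depth v x3 + 3).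
  by rewrite (depth_link n3 v1 v3 n13 le).
by rewrite (depth_link n3 v2 v4 n24) ?orbT //; lia.
Qed.

Lemma link_cycle_HL n (G : sgraph) (v : G) (s : seq G) : uniq s -> cycle (link n v) s ->
  exists s' : seq (HL n G), [/\ uniq s', size s' = size s & cycle (@adj (HL n G)) s'].
Proof.
case: s => [|a s] us cs; first by exists [::].
have sN : all (mem (nbrs v)) (a :: s).
  by apply/allP => x xs; rewrite !inE; case/and3P: (next_cycle cs xs).
have va : [set v; a] \in edges G by rewrite edgesE; case/andP: sN; rewrite !inE.
(* The default edge [va] is returned only for non-neighbours of [v], and none of these lies on the
   cycle. *)
pose h x : HL n G := insubd (exist _ [set v; a] va) [set v; x].
have hE x : adj v x -> val (h x) = [set v; x] by move=> vx; rewrite insubdK // edgesE.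
exists (map h (a :: s)); split; rewrite ?size_map //.
  rewrite map_inj_in_uniq // => x y /(allP sN) + /(allP sN); rewrite !inE => vx vy.
  move/(congr1 val); rewrite !hE // => /eqP; rewrite eq_set2 eqxx /=.
  by rewrite (negPf (adj_neq vy)) orbF => /eqP.
apply: (homo_cycle_in _ sN cs) => x y; rewrite !inE => vx vy /and3P[_ _].
by rewrite -!hE.
Qed.

(** Both pairs close up to cycles through [v], which have the same edges by unicyclicity; those at
    [v] are [vx] and [vy]. So at most one pair of neighbours is connected away from [v]. *)
Lemma unicyclic_away (G : sgraph) (v x y x' y' : G) : all_components_unicyclic G ->
  adj v x -> adj v y -> x != y -> adj v x' -> adj v y' -> x' != y' ->
  connect (away v) x y -> connect (away v) x' y' -> x' \in [:: x; y].
Proof.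
move=> uG vx vy xy vx' vy' xy' cxy cxy'.
have [s [us ss cs vs es]] := away_cycle vx vy xy cxy.
have [t [ut st ct vt et]] := away_cycle vx' vy' xy' cxy'.
rewrite !inE -es; apply: (components_cedges uG ut st ct vt us ss cs vs).
by rewrite et eqxx.
Qed.

(* A cycle of the link has length at least 5, so it contains four consecutive vertices to
   which the chord lemma applies without meeting the pair of edges of the cycle through [v];
   the chord yields a triangle. *)
Lemma unicyclic_link_acyclic n (G : sgraph) (v : G) : 3 <= n ->
  all_components_unicyclic G -> girth_gt (HL n G) 4 -> acyclic (link n v).
Proof.
move=> n3 uG gG.
have long s : uniq s -> 2 < size s -> cycle (link n v) s -> 4 < size s.
  move=> us ss cs; have [s' [us' E cs']] := link_cycle_HL us cs.
  by rewrite -E; apply: girth_gt_cycle gG us' _ cs'; rewrite E.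
have tri x y z : link n v x y -> link n v y z -> link n v x z = false.
  move=> xy yz; apply/negP => xz.
  have : uniq [:: x; y; z].
    by rewrite /= !inE negb_or (link_neq xy) (link_neq xz) (link_neq yz).
  by move/long => /=; rewrite xy yz link_sym xz => /(_ isT isT).
have chain a b c d : link n v a b -> link n v b c -> link n v c d -> a != c -> b != d ->
    connect (away v) a c || connect (away v) b d.
  move=> ab bc cd ac bd; apply/negPn/negP => /norP[nac nbd].
  have := link_chord n3 ab cd nac nbd.
  by rewrite (tri _ _ _ ab bc) (tri _ _ _ bc cd).
move=> s us ss cs; have := long s us ss cs.
case: s us cs {ss} => [|a [|b [|c [|d [|e t]]]]] //= us cs _.
case/and5P: cs => ab bc cd de; rewrite rcons_path => ct.
(* The vertex after [e], which is [a] again if the cycle has length 5. *)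
have [f [ef fb fd]] : exists f, [/\ link n v e f, f != b & f != d].
  case: t us ct => [|f t] /=; rewrite !inE !negb_or.
    move=> /and5P[/and4P[/negPf ab' _ /negPf ad _] _ _ _ _] ea.
    by exists a; rewrite ab' ad.
  move=> /and5P[_ /and5P[_ _ _ bf _] _ /and3P[_ df _] _] /andP[/andP[ef _] _].
  by exists f; rewrite ![f == _]eq_sym.
have nb x y : link n v x y -> adj v x by case/and3P.
have [va [vb vc]] : adj v a /\ adj v b /\ adj v c.
  by rewrite (nb _ _ ab) (nb _ _ bc) (nb _ _ cd).
have [vd [ve vf]] : adj v d /\ adj v e /\ adj v f.
  by rewrite (nb _ _ de) (nb _ _ ef) (nb f e) // link_sym.
move: us; rewrite /= !inE !negb_or.
case/and5P=> /and5P[nab nac nad nae _] /and4P[nbc nbd nbe _] /and3P[ncd nce _] /andP[nde _] _.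
(* Only one pair can be connected away from [v]. If it is [a], [c], then [b c d e] would need [b],
   [d] or [c], [e]; if it is [b], [d], then [c d e f] would need [c], [e] or [d], [f]. *)
case/orP: (chain _ _ _ _ ab bc cd nac nbd) => [cac|cbd].
  case/orP: (chain _ _ _ _ bc cd de nbd nce) => [c'|c'].
    have := unicyclic_away uG va vc nac vb vd nbd cac c'.
    by rewrite !inE eq_sym (negPf nab) (negPf nbc).
  have := unicyclic_away uG va vc nac ve vc _ cac; rewrite eq_sym nce away_connect_sym c'.
  by move/(_ isT isT); rewrite !inE ![e == _]eq_sym (negPf nae) (negPf nce).
have ndf : d != f by rewrite eq_sym.
case/orP: (chain _ _ _ _ cd de ef nce ndf) => [c'|c'].
  have := unicyclic_away uG vb vd nbd vc ve nce cbd c'.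
  by rewrite !inE ![c == _]eq_sym (negPf nbc) eq_sym (negPf ncd).
have := unicyclic_away uG vb vd nbd vf vd fd cbd; rewrite away_connect_sym c'.
by move/(_ isT); rewrite !inE (negPf fb) (negPf fd).
Qed.

(** * Embeddings and convergence *)

(** Adjacency need not be reflected: the image is a subgraph, not necessarily induced, and [HL] is
    monotone for this relation. *)
Definition emb (X Y : sgraph) := exists2 f : X -> Y, injective f & {homo f : x y / adj x y}.

Lemma emb_trans (X Y Z : sgraph) : emb X Y -> emb Y Z -> emb X Z.
Proof.
case=> f fi fh [g gi gh]; exists (g \o f); first exact: inj_comp.
by move=> x y /fh/gh.
Qed.

Lemma emb_card (X Y : sgraph) : emb X Y -> #|X| <= #|Y|.
Proof. by case=> f fi _; exact: leq_card fi. Qed.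

(** Produces embeddings between graphs on subtypes or sums by choosing images, without defining the
    map by cases on membership proofs. *)
Lemma emb_rel (X Y : sgraph) (P : X -> Y -> bool) : (forall x, exists y, P x y) ->
  (forall x x' y, P x y -> P x' y -> x = x') ->
  (forall x x' y y', adj x x' -> P x y -> P x' y' -> adj y y') -> emb X Y.
Proof.
move=> Pe Pi Ph; exists (fun x => xchoose (Pe x)).
  move=> x x' /= E; have := xchooseP (Pe x'); rewrite -E.
  exact: Pi _ _ _ (xchooseP (Pe x)).
by move=> x x' xx'; apply: Ph xx' _ _; exact: xchooseP.
Qed.

Lemma iso_emb (X Y : sgraph) : isomorphic X Y -> emb X Y /\ emb Y X.
Proof.
case/isomorphicP=> f fb fm; have [g fK gK] := fb; split.
  by exists f; [exact: bij_inj | move=> x y; rewrite fm].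
by exists g; [exact: can_inj gK | move=> x y; rewrite -fm !gK].
Qed.

(** Finiteness: the graphs have equally many vertices and arcs, so [f] is bijective and the images
    of the arcs of [X] exhaust those of [Y]. *)
Lemma emb_iso (X Y : sgraph) : emb X Y -> emb Y X -> isomorphic X Y.
Proof.
case=> f fi fh /[dup] /emb_card cYX [g gi gh].
have arcs (A B : sgraph) (h : A -> B) : injective h -> {homo h : x y / adj x y} ->
    #|[set (h p.1, h p.2) | p in [set p : A * A | adj p.1 p.2]]| = narcs (@adj A) /\
    [set (h p.1, h p.2) | p in [set p : A * A | adj p.1 p.2]]
      \subset [set p : B * B | adj p.1 p.2].
  move=> hi hh; split.
    by rewrite card_imset // => -[a b] [c d] [/hi-> /hi->].
  by apply/subsetP => _ /imsetP[[a b] + ->]; rewrite !inE; exact: hh.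
have [cf sf] := arcs _ _ f fi fh; have [cg sg] := arcs _ _ g gi gh.
have le : narcs (@adj Y) <= narcs (@adj X) by rewrite -cg subset_leq_card.
apply/isomorphicP; exists f; first exact: inj_card_bij.
move=> x y; apply/idP/idP; last exact: fh.
have /setP/(_ (f x, f y)) : [set (f p.1, f p.2) | p in [set p : X * X | adj p.1 p.2]] =
    [set p : Y * Y | adj p.1 p.2] by apply/eqP; rewrite eqEcard sf cf.
rewrite [RHS]inE /= => <- /imsetP[[a b]]; rewrite inE /= => ab.
by case=> /fi-> /fi->.
Qed.

Lemma paired_map n (X Y : sgraph) (f : X -> Y) (v x y : X) : injective f ->
  {homo f : x y / adj x y} -> paired n v x y -> paired n (f v) (f x) (f y).
Proof.
move=> fi fh [p [q [u px py sz]]]; exists (map f p), (map f q); split.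
- by rewrite -!map_cons -map_cat -map_cons map_inj_uniq.
- exact: (homo_path (s := x :: p) fh).
- exact: (homo_path (s := y :: q) fh).
- by rewrite !size_map.
Qed.

Lemma imset_set2 (S T : finType) (f : S -> T) (x y : S) :
  [set f z | z in [set x; y]] = [set f x; f y].
Proof. by rewrite imsetU1 imset_set1. Qed.

Lemma emb_HL n (X Y : sgraph) : emb X Y -> emb (HL n X) (HL n Y).
Proof.
case=> f fi fh.
have fE (e : HL n X) : f @: val e \in edges Y.
  have /edgesP[x [y [xy ->]]] := valP e.
  by rewrite imset_set2 edgesE fh.
exists (fun e : HL n X => exist _ (f @: val e) (fE e) : HL n Y).
  by move=> e1 e2 [] /(imset_inj fi) /val_inj.
move=> e1 e2 /(path_adjacent_link (valP e1) (valP e2))[v [x [y [E1 E2 l]]]].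
rewrite [adj _ _]/(path_adjacent n (f @: val e1) (f @: val e2)) E1 E2 !imset_set2.
by apply/paired_path_adjacent/paired_map => //; apply/linkP.
Qed.

Lemma HL_iterS n k (X : sgraph) : HL_iter n k.+1 X = HL_iter n k (HL n X).
Proof. exact: iterSr. Qed.

Lemma emb_HL_iter n k (X Y : sgraph) : emb X Y -> emb (HL_iter n k X) (HL_iter n k Y).
Proof. by move=> e; elim: k => //= k; exact: emb_HL. Qed.

Lemma HL_iter_empty n (X : sgraph) k l : k <= l -> #|HL_iter n k X| = 0 ->
  #|HL_iter n l X| = 0.
Proof.
move/subnK <-; elim: (l - k) => // m IH /IH E; rewrite addSn [HL_iter _ _ _]/= card_HL.
apply/eqP; rewrite cards_eq0; apply/eqP/setP => e; rewrite in_set0.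
by apply/negP => /edgesP[x _]; have := card0_eq E x; rewrite inE.
Qed.

(** * Disjoint unions *)

Definition dunion_adj (X Y : sgraph) : rel (X + Y) := fun u v =>
  match u, v with
  | inl x, inl x' => adj x x'
  | inr y, inr y' => adj y y'
  | _, _ => false
  end.

Lemma dunion_adj_sym (X Y : sgraph) : symmetric (@dunion_adj X Y).
Proof. by move=> [x|y] [x'|y'] //=; exact: adj_sym. Qed.

Lemma dunion_adj_irrefl (X Y : sgraph) : irreflexive (@dunion_adj X Y).
Proof. by move=> [x|y] /=; exact: adj_irrefl. Qed.

Definition dunion (X Y : sgraph) : sgraph :=
  SGraph (@dunion_adj_sym X Y) (@dunion_adj_irrefl X Y).

Lemma emb_dunion0 (X Y : sgraph) : #|Y| = 0 -> emb (dunion X Y) X.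
Proof.
move=> Y0; have noY (y : Y) : False by have := card0_eq Y0 y; rewrite inE.
exists (fun u : dunion X Y => match u with inl x => x | inr y => False_rect _ (noY y) end).
  by move=> [x|y]; [move=> [x'|y'] /=; [move=> -> | case: (noY y')] | case: (noY y)].
by move=> [x|y]; [move=> [x'|y'] | case: (noY y)].
Qed.

(** The image of [i] is closed under adjacency, so a [P_n] with one edge in it lies there entirely
    and pulls back to [X]. *)
Lemma path_adjacent_summand n (X Z : sgraph) (i : X -> Z) (e1 e2 : {set Z}) (a : {set X}) :
  injective i -> (forall x z, adj (i x) z -> exists2 x', z = i x' & adj x x') ->
  e1 \in edges Z -> e2 \in edges Z -> path_adjacent n e1 e2 -> e1 = i @: a ->
  exists2 a' : {set X}, e2 = i @: a' & path_adjacent n a a'.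
Proof.
move=> ii ic E1 E2 /(path_adjacent_link E1 E2)[v [x [y [F1 F2 /linkP l]]]] Ea.
have [w Ev] : exists w, v = i w.
  have : v \in i @: a by rewrite -Ea F1 set21.
  by case/imsetP=> w _ ->; exists w.
have iP (u : X) (p : seq Z) : path (@adj Z) (i u) p ->
    exists2 p', p = map i p' & path (@adj X) u p'.
  elim: p u => [|z p IH] u /=; first by exists [::].
  by case/andP=> /ic[x' -> ux] /IH[p' -> pp]; exists (x' :: p'); rewrite //= ux.
rewrite {v}Ev in F1 F2 l.
case: l => p [q [u /iP[p1 Ep1 px] /iP[q1 Eq1 py] sz]].
case: p1 Ep1 px => [|x' p'] // [Ex Ep] px; case: q1 Eq1 py => [|y' q'] // [Ey Eq] py.
have l : paired n w x' y'.
  exists p', q'; split=> //; last by move: sz; rewrite Ep Eq !size_map.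
  by rewrite -(map_inj_uniq ii) /= map_cat /= -Ex -Ep -Ey -Eq.
exists [set w; y']; first by rewrite F2 Ey imset_set2.
have -> : a = [set w; x'] by apply: (imset_inj ii); rewrite -Ea F1 Ex imset_set2.
exact: paired_path_adjacent.
Qed.

Lemma emb_HL_dunion n (X Y : sgraph) :
  emb (HL n (dunion X Y)) (dunion (HL n X) (HL n Y)).
Proof.
have inl_inj : injective (inl : X -> dunion X Y) by move=> ? ? [].
have inr_inj : injective (inr : Y -> dunion X Y) by move=> ? ? [].
have disj (a : {set X}) (b : {set Y}) : a \in edges X ->
    (inl : X -> dunion X Y) @: a = inr @: b -> False.
  case/edgesP=> x [y [_ ->]] /setP/(_ (inl x)).
  by rewrite imset_f ?set21 // => /esym/imsetP[].
have inlP (x : X) (z : dunion X Y) : adj (inl x : dunion X Y) z ->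
  exists2 x', z = inl x' & adj x x' by case: z => // x'; exists x'.
have inrP (x : Y) (z : dunion X Y) : adj (inr x : dunion X Y) z ->
  exists2 x', z = inr x' & adj x x' by case: z => // x'; exists x'.
pose P (e : HL n (dunion X Y)) (u : dunion (HL n X) (HL n Y)) :=
  match u with
  | inl a => val e == inl @: val a
  | inr b => val e == inr @: val b
  end.
apply: (@emb_rel _ _ P).
- move=> e; have /edgesP[[x|x] [[y|y] [xy E]]] := valP e; rewrite //= in xy.
    have xyE : [set x; y] \in edges X by rewrite edgesE.
    by exists (inl (exist _ [set x; y] xyE)); rewrite /P E /= imset_set2.
  have xyE : [set x; y] \in edges Y by rewrite edgesE.
  by exists (inr (exist _ [set x; y] xyE)); rewrite /P E /= imset_set2.
- by move=> e1 e2 [a|b] /eqP E1 /eqP E2; apply: val_inj; rewrite E1.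
move=> e1 e2 [a1|b1] u2 a12 /eqP E1.
  have [a' Ea' pa] := path_adjacent_summand inl_inj inlP (valP e1) (valP e2) a12 E1.
  case: u2 => [a2|b2] /eqP; rewrite Ea'.
    by move=> /(imset_inj inl_inj) Ea; rewrite Ea in pa.
  by case/disj; case/and3P: pa => _ _ /existsP[S /and3P[_ _]];
    case/andP: (valP S) => /subsetP + _; apply.
have [b' Eb' pb] := path_adjacent_summand inr_inj inrP (valP e1) (valP e2) a12 E1.
case: u2 => [a2|b2] /eqP; rewrite Eb'; first by move/esym/disj; case; exact: (valP a2).
by move=> /(imset_inj inr_inj) Eb; rewrite Eb in pb.
Qed.

(** * Restriction to a set of edges *)

Definition restr_adj (G : sgraph) (F : {set {set G}}) : rel G :=
  fun x y => adj x y && ([set x; y] \in F).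

Lemma restr_adj_sym (G : sgraph) (F : {set {set G}}) : symmetric (restr_adj F).
Proof. by move=> x y; rewrite /restr_adj adj_sym setUC. Qed.

Lemma restr_adj_irrefl (G : sgraph) (F : {set {set G}}) : irreflexive (restr_adj F).
Proof. by move=> x; rewrite /restr_adj adj_irrefl. Qed.

(** All vertices are kept, so the vertex type stays that of [G]; those left isolated vanish at the
    first application of [HL]. *)
Definition restr (G : sgraph) (F : {set {set G}}) : sgraph :=
  SGraph (restr_adj_sym F) (restr_adj_irrefl F).

(** The middle of the [P_n] is moved one step along [x :: p], with [v] joining the other arm; at
    each position the hypothesis passes membership in [F] to the next edge. *)
Lemma restr_path n (G : sgraph) (F : {set {set G}}) :
  (forall v x y, paired n v x y -> ([set v; x] \in F) = ([set v; y] \in F)) ->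
  forall (p q : seq G) v x y, uniq (v :: (x :: p) ++ y :: q) ->
    path (@adj G) v (x :: p) -> path (@adj G) v (y :: q) -> size p + size q + 3 = n ->
    [set v; x] \in F -> path (@adj (restr F)) v (x :: p).
Proof.
move=> cF; elim=> [|x1 p IH] q v x y u px py sz vxF.
  by rewrite /= /restr_adj vxF !andbT; case/andP: px.
have [vx px1] : adj v x /\ path (@adj G) x (x1 :: p) by apply/andP.
rewrite [path _ _ _]/= -/(path (@adj (restr F)) x (x1 :: p)) {1}/restr_adj vx vxF.
have u' : uniq (x :: (x1 :: p) ++ v :: y :: q).
  rewrite (perm_uniq (_ : perm_eq _ (v :: (x :: x1 :: p) ++ y :: q))) //.
  by rewrite -cat_cons perm_catC /= perm_cons -!cat_cons perm_catC.
have py' : path (@adj G) x (v :: y :: q) by rewrite /= adj_sym vx.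
have sz' : size p + size (y :: q) + 3 = n by move: sz => /=; lia.
have pn : paired n x x1 v by exists p, (y :: q).
by apply: IH u' px1 py' sz' _; rewrite (cF _ _ _ pn) setUC.
Qed.

Lemma restr_paired n (G : sgraph) (F : {set {set G}}) (v x y : G) :
  (forall v x y, paired n v x y -> ([set v; x] \in F) = ([set v; y] \in F)) ->
  paired n v x y -> [set v; x] \in F -> paired (G := restr F) n v x y.
Proof.
move=> cF pxy vxF; have vyF : [set v; y] \in F by rewrite -(cF _ _ _ pxy).
case: pxy => p [q [u px py sz]]; exists p, q; split=> //.
  exact: (restr_path cF u px py sz).
apply: (restr_path cF (q := p) (y := x)) => //; last by rewrite (addnC (size q)).
by rewrite (perm_uniq (_ : perm_eq _ (v :: (x :: p) ++ y :: q))) // perm_cons perm_catC.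
Qed.

Lemma restr_edges (G : sgraph) (F : {set {set G}}) : edges (restr F) = edges G :&: F.
Proof.
apply/setP => e; rewrite [in RHS]inE; apply/edgesP/andP.
  by case=> x [y [/andP[xy xyF] ->]]; rewrite edgesE.
by case=> /edgesP[x [y [xy ->]] xyF]; exists x, y; split=> //=; rewrite /restr_adj xy.
Qed.

Lemma emb_HL_restr n (G : sgraph) (F : {set {set G}}) :
  {in edges G &, forall e1 e2, path_adjacent n e1 e2 -> (e1 \in F) = (e2 \in F)} ->
  emb (HL n G) (dunion (HL n (restr (~: F))) (HL n (restr F))).
Proof.
move=> cF.
have cF1 v x y : paired n v x y -> ([set v; x] \in F) = ([set v; y] \in F).
  move=> pxy; apply: cF (paired_path_adjacent pxy); rewrite edgesE;
    by case: pxy => p [q [_ /andP[vx _] /andP[vy _] _]].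
have cF2 v x y : paired n v x y -> ([set v; x] \in ~: F) = ([set v; y] \in ~: F).
  by rewrite !in_setC => /cF1 ->.
pose P (e : HL n G) (u : dunion (HL n (restr (~: F))) (HL n (restr F))) :=
  match u with
  | inl a => val e == (val a : {set G})
  | inr b => val e == (val b : {set G})
  end.
apply: (@emb_rel _ _ P).
- move=> e; have eE := valP e; have [eF|eF] := boolP (val e \in F).
    have eE' : val e \in edges (restr F) by rewrite restr_edges inE eE.
    by exists (inr (exist (fun a => a \in edges (restr F)) _ eE')); rewrite /P /=.
  have eE' : val e \in edges (restr (~: F)) by rewrite restr_edges inE eE inE.
  by exists (inl (exist (fun a => a \in edges (restr (~: F))) _ eE')); rewrite /P /=.
- by move=> e1 e2 [a|b] /eqP E1 /eqP E2; apply: val_inj; rewrite E1.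
move=> e1 e2 u1 u2 a12; have := cF _ _ (valP e1) (valP e2) a12.
have [v [x [y [E1 E2 /linkP l]]]] := path_adjacent_link (valP e1) (valP e2) a12.
have inF (a : HL n (restr F)) : val a \in F.
  have : (val a : {set G}) \in edges G :&: F by rewrite -restr_edges (valP a).
  by rewrite inE => /andP[].
have ninF (a : HL n (restr (~: F))) : (val a \in F) = false.
  have : (val a : {set G}) \in edges G :&: ~: F by rewrite -restr_edges (valP a).
  by rewrite 2!inE in_setC => /andP[_ /negbTE].
case: u1 u2 => [a1|b1] [a2|b2] /[swap] /eqP F1 /[swap] /eqP F2;
  rewrite F1 F2 ?ninF ?inF // => _.
  rewrite [adj _ _]/(path_adjacent n (val a1) (val a2)) -F1 -F2 E1 E2.
  apply: (@paired_path_adjacent n (restr (~: F))); apply: restr_paired => //.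
  by rewrite -E1 F1 in_setC ninF.
rewrite [adj _ _]/(path_adjacent n (val b1) (val b2)) -F1 -F2 E1 E2.
apply: (@paired_path_adjacent n (restr F)); apply: restr_paired => //.
by rewrite -E1 F1 inF.
Qed.

(** * Convergence and embeddings *)

Lemma convergent_bounded n (G : sgraph) : convergent n G ->
  exists B, forall k, #|HL_iter n k G| <= B.
Proof.
case=> _ [N /iso_emb[_ e]].
(* The embedding of iterate [N + 1] into iterate [N] is pushed forward by [HL], so sizes do not
   increase from [N] on. *)
have le k : #|HL_iter n (k + N) G| <= #|HL_iter n N G|.
  elim: k => // k IH; apply: leq_trans IH; apply: emb_card.
  by rewrite addSnnS /HL_iter !iterD; exact: emb_HL_iter.
exists (\max_(i < N.+1) #|HL_iter n i G|) => k.
have [kN|Nk] := leqP k N.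
  exact: (@leq_bigmax _ (fun i : 'I_N.+1 => #|HL_iter n i G|) (Ordinal (kN : k < N.+1))).
rewrite -(subnK (ltnW Nk)); apply: leq_trans (le _) _.
exact: (@leq_bigmax _ (fun i : 'I_N.+1 => #|HL_iter n i G|) ord_max).
Qed.

(** Empty iterates stay empty and isomorphic consecutive iterates stay isomorphic, so both halves of
    convergence can be tested from step [k] on, where the iterates of [X] and [Y] embed into each
    other. *)
Lemma convergent_eventually n (X Y : sgraph) k :
  (forall m, k <= m -> emb (HL_iter n m X) (HL_iter n m Y)) ->
  (forall m, k <= m -> emb (HL_iter n m Y) (HL_iter n m X)) ->
  convergent n X -> convergent n Y.
Proof.
move=> XY YX [nt [N /iso_emb[e e']]]; split.
  case=> m Y0; apply: nt; exists (maxn k m); apply/eqP; rewrite -leqn0.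
  rewrite -(HL_iter_empty (leq_maxr k m) Y0).
  by apply/emb_card/XY; exact: leq_maxl.
have XS m : N <= m -> emb (HL_iter n m X) (HL_iter n m.+1 X) /\
    emb (HL_iter n m.+1 X) (HL_iter n m X).
  move=> /subnK <-; rewrite -addnS /HL_iter !iterD.
  by split; exact: emb_HL_iter.
exists (maxn k N); have [mk mN] := (leq_maxl k N, leq_maxr k N).
move: (maxn k N) mk mN => m mk /XS[e1 e2]; have mk' := leqW mk.
by apply: emb_iso; [apply: emb_trans (YX _ mk) (emb_trans e1 (XY _ mk'))
  | apply: emb_trans (YX _ mk') (emb_trans e2 (XY _ mk))].
Qed.

Lemma convergent_restr n (G : sgraph) (F : {set {set G}}) :
  {in edges G &, forall e1 e2, path_adjacent n e1 e2 -> (e1 \in F) = (e2 \in F)} ->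
  terminates n (restr F) -> convergent n G -> convergent n (restr (~: F)).
Proof.
(* The two restrictions share all vertices of [G], so the splitting into a disjoint union holds only
   after one application of [HL]; hence [k.+1]. *)
move=> cF [k F0]; apply: (@convergent_eventually _ _ _ k.+1); last first.
  by move=> m _; apply: emb_HL_iter; exists id => // x y /andP[].
have emb_m m : emb (HL_iter n m.+1 G)
    (dunion (HL_iter n m.+1 (restr (~: F))) (HL_iter n m.+1 (restr F))).
  elim: m => [|m IH]; first exact: emb_HL_restr.
  exact: emb_trans (emb_HL n IH) (emb_HL_dunion _ _ _).
case=> // m km; apply: emb_trans (emb_m m) (emb_dunion0 _ _).
by apply: HL_iter_empty F0; apply: leqW.
Qed.

(** Otherwise deleting the edges in [F], among them [e], would leave a convergent proper subgraph.
    Its vertices form a sigma type, whence the comparison with [restr (~: F)] by embeddings. *)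
Lemma not_terminates_restr n (G : sgraph) (F : {set {set G}}) (e : {set G}) :
  minimally_convergent n G ->
  {in edges G &, forall e1 e2, path_adjacent n e1 e2 -> (e1 \in F) = (e2 \in F)} ->
  e \in edges G -> e \in F -> ~ terminates n (restr F).
Proof.
move=> [cG mG] cF eE eF tF.
have sS : is_subgraph (G := G) ([set: G], edges G :\: F).
  rewrite /is_subgraph subsetDl; apply/forall_inP => f _; exact: subsetT.
pose S : subgraph G := exist (is_subgraph (G := G)) _ sS.
apply: (mG S).
  apply/orP; right; apply: contraTneq eE => <-; by rewrite /sub_edges /= inE eF.
have vS (x : G) : x \in sub_vertices S by rewrite /sub_vertices /= inE.
have adjS x y : (restr_adj (~: F) x y) = ([set x; y] \in sub_edges S).
  by rewrite /restr_adj /sub_edges [RHS]inE edgesE in_setC andbC.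
apply: (@convergent_eventually _ (restr (~: F)) _ 0); last exact: convergent_restr.
  move=> m _; apply: emb_HL_iter.
  exists (fun x => exist (fun x => x \in sub_vertices S) x (vS x)) => [x y []|x y] //.
  by rewrite [adj x y]adjS.
move=> m _; apply: emb_HL_iter; exists val; first exact: val_inj.
by move=> x y xy; rewrite [adj _ _]adjS.
Qed.

(** * Graphs in which all incident edges are [P_n]-adjacent *)

(** Says that [HL n X] is the line graph of [X]. *)
Definition full n (X : sgraph) :=
  forall v x y : X, adj v x -> adj v y -> x != y -> paired n v x y.

Definition incident (T : finType) : rel {set T} :=
  fun e f => (e != f) && (e :&: f != set0).

Lemma incidentI (T : finType) (e f : {set T}) u : e != f -> u \in e -> u \in f -> incident e f.
Proof. by rewrite /incident => -> ue uf; apply/set0Pn; exists u; rewrite inE ue. Qed.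

Lemma full_incident n (X : sgraph) (e f : {set X}) : full n X -> e \in edges X ->
  f \in edges X -> incident e f -> path_adjacent n e f.
Proof.
move=> fX eE fE /andP[ef /set0Pn[v]]; rewrite inE => /andP[ve vf].
have [x vx Ex] := edges_at eE ve; have [y vy Ey] := edges_at fE vf.
rewrite Ex Ey; apply: paired_path_adjacent; apply: fX => //.
by apply: contraNneq ef => xy; rewrite Ex Ey xy.
Qed.

(** In a full graph, a long enough sequence of distinct edges, each incident to the next, is a path
    of [HL n X]. This permits working with plain sets instead of the vertex type of [HL n X]. *)
Lemma HL_pairedI n (X : sgraph) (F E D : HL n X) (p q : seq {set X}) :
  full n X -> 3 <= n -> uniq (val F :: (val E :: p) ++ val D :: q) ->
  {subset p <= edges X} -> {subset q <= edges X} ->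
  path (@incident X) (val F) (val E :: p) -> path (@incident X) (val F) (val D :: q) ->
  n <= size p + size q + 3 -> paired n F E D.
Proof.
move=> fX n3 u pE qE pp pq; have /all_sigP[p' Ep] : all (mem (edges X)) p by apply/allP.
have /all_sigP[q' Eq] : all (mem (edges X)) q by apply/allP.
have lift (A : HL n X) (s : seq (HL n X)) :
    path (@incident X) (val A) (map val s) -> path (@adj (HL n X)) A s.
  rewrite path_map; apply: sub_path => a b; apply: full_incident => //; exact: valP.
rewrite {}Ep {}Eq !size_map in u pp pq *.
apply: (@paired_leq n (HL n X) F E D p' q') => //; last 2 first.
- exact: (lift F (E :: p') pp).
- exact: (lift F (D :: q') pq).
by rewrite -(map_inj_uniq val_inj) /= map_cat.
Qed.

(** * Edge sequences of paths *)

Definition trail (T : finType) (v : T) (p : seq T) := pairmap (fun a b => [set a; b]) v p.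

Lemma size_trail (T : finType) (v : T) p : size (trail v p) = size p.
Proof. exact: size_pairmap. Qed.

Lemma trail_edges (X : sgraph) (v : X) p : path (@adj X) v p -> {subset trail v p <= edges X}.
Proof.
elim: p v => //= x p IH v /andP[vx pp] e; rewrite inE => /orP[/eqP->|]; last exact: IH.
by rewrite edgesE.
Qed.

Lemma mem_trail (T : finType) (v : T) p e : e \in trail v p -> {subset e <= v :: p}.
Proof.
elim: p v => //= x p IH v; rewrite inE => /orP[/eqP->|/IH sub] u.
  by rewrite !inE => /orP[]->; rewrite ?orbT.
by rewrite [_ \in v :: _]inE => /sub ->; rewrite orbT.
Qed.

Lemma trail_head (T : finType) (v x : T) p e : uniq (v :: x :: p) ->
  e \in trail v (x :: p) -> v \in e -> e = [set v; x].
Proof.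
by case/andP=> vp _; rewrite inE => /orP[/eqP//|/mem_trail sub /sub]; rewrite (negPf vp).
Qed.

Lemma trail_uniq (T : finType) (v : T) p : uniq (v :: p) -> uniq (trail v p).
Proof.
elim: p v => //= x p IH v /andP[vp up]; rewrite IH // andbT.
by apply: contra vp => /mem_trail; apply; rewrite !inE eqxx.
Qed.

Lemma trail_path (T : finType) (v x : T) p : uniq (v :: x :: p) ->
  path (@incident T) [set v; x] (trail x p).
Proof.
elim: p v x => //= y p IH v x /andP[vp up]; rewrite IH // andbT.
apply: (@incidentI _ _ _ x); rewrite ?set21 ?set22 //.
apply: contraNneq vp => /setP/(_ v); rewrite set21 => /esym; rewrite !inE.
by case/orP=> ->; rewrite ?orbT.
Qed.

(** The arms share only [v], so a common edge would be contained in [[set v]]. *)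
Lemma trail_cat_uniq (T : finType) (v : T) p q : uniq (v :: p ++ q) ->
  (forall e, e \in trail v p -> #|e| = 2) -> uniq (trail v p ++ trail v q).
Proof.
rewrite cons_uniq mem_cat negb_or cat_uniq => /andP[/andP[vp vq] /and3P[up dpq uq]] e2.
have u1 : uniq (trail v p) by apply: trail_uniq; rewrite cons_uniq vp.
have u2 : uniq (trail v q) by apply: trail_uniq; rewrite cons_uniq vq.
rewrite cat_uniq u1 u2 andbT /=; apply/hasPn => e eq; apply/negP => ep.
have : e \subset [set v].
  apply/subsetP => u ue; rewrite inE; have := mem_trail ep ue; have := mem_trail eq ue.
  rewrite !inE; case: eqVneq => //= _ uq' up'.
  by case/hasP: dpq; exists u.
by move/subset_leq_card; rewrite cards1 (e2 _ ep).
Qed.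

Lemma card_edge (X : sgraph) (e : {set X}) : e \in edges X -> #|e| = 2.
Proof. by case/edgesP=> x [y [xy ->]]; rewrite cards2 (adj_neq xy). Qed.

Lemma paired_trail n (X : sgraph) (c a b : X) : paired n c a b -> exists p q,
  [/\ [/\ uniq (c :: a :: p), uniq (c :: b :: q) & n = size p + size q + 3],
      c \notin a :: p /\ c \notin b :: q, a \notin b :: q /\ b \notin a :: p,
      {subset trail c (a :: p) <= edges X} /\ {subset trail c (b :: q) <= edges X}
    & uniq (trail c (a :: p) ++ trail c (b :: q))].
Proof.
case=> p [q [u pp pq sz]]; exists p, q; split=> //.
- move: u; rewrite cons_uniq mem_cat negb_or cat_uniq.
  by case/andP=> /andP[cp cq] /and3P[up _ uq]; rewrite ![uniq (c :: _)]cons_uniq cp cq up uq sz.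
- by move: u; rewrite cons_uniq mem_cat negb_or => /andP[/andP[]].
- move: u; rewrite cons_uniq cat_uniq => /andP[_ /and3P[_ /hasPn d _]]; split.
    by apply/negP => /d; rewrite /= inE eqxx.
  by apply: d; rewrite inE eqxx.
- by split; apply: trail_edges.
- by apply: trail_cat_uniq => // e /(trail_edges pp); exact: card_edge.
Qed.

(** The edge [h], attached at [u], is put between the two edges of the path at [u], or at the end if
    [u] is the last vertex. *)
Lemma insert_trail (T : finType) (v x u : T) p (h : {set T}) : uniq (v :: x :: p) -> u \in x :: p ->
  u \in h -> h \notin trail v (x :: p) ->
  exists2 s, path (@incident T) [set v; x] s & perm_eq s (h :: trail x p).
Proof.
elim: p v x => [|y p IH] v x uv.
  rewrite !inE => /eqP-> xh hn; exists [:: h] => //=; rewrite andbT.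
  by apply: (@incidentI _ _ _ x); rewrite ?set22 // eq_sym.
rewrite [u \in _]inE => /orP[/eqP-> xh|up uh]; rewrite [h \in _]inE negb_or => /andP[hv hn].
  exists (h :: trail x (y :: p)) => //=; rewrite (@incidentI _ _ _ x) ?set22 1?eq_sym //=.
  rewrite (@incidentI _ _ _ x) ?set21 //=; last by move: hn; rewrite inE negb_or => /andP[].
  by apply: trail_path; case/andP: uv.
have uxy : uniq (x :: y :: p) by case/andP: uv.
have [s ps es] := IH _ _ uxy up uh hn.
exists ([set x; y] :: s).
  by have := trail_path uv => /= /andP[-> _].
rewrite /= -cat1s -[h :: _ :: _]/([:: h] ++ [:: [set x; y]] ++ trail y p) perm_sym perm_catCA.
by rewrite perm_cat2l perm_sym.
Qed.

(** If [cd] is off the path, it is inserted at [c] and all of [trail c q] follows. If it is on the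
    path, it is the first edge of [trail c q], and the remainder is one edge shorter. *)
Lemma trail_detour (T : finType) (b c d : T) q : uniq (b :: c :: q) -> d != b ->
  exists s, [/\ path (@incident T) [set b; c] ([set c; d] :: s), uniq ([set c; d] :: s),
    {subset [set c; d] :: s <= [set c; d] :: trail c q} &
    size q <= size s + ([set c; d] \in trail c q)].
Proof.
move=> u db; have uc : uniq (c :: q) by case/andP: u.
have [gq|gq] := boolP (_ \in _).
  case: q gq u uc => // y q gq u uc.
  have E := trail_head uc gq (set21 c d).
  have tu := trail_uniq uc; have tp := trail_path u.
  exists (trail y q); rewrite E; split=> //; first by move=> z zs; apply/orP; right.
  by rewrite size_trail addn1.
exists (trail c q); split=> //; last by rewrite size_trail addn0.
  rewrite /= (@incidentI _ _ _ c) ?set21 ?set22 //=; last first.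
    rewrite eq_set2 [b == d]eq_sym (negPf db) !(andbF, orbF).
    by apply/negP => /andP[/eqP bc _]; rewrite bc /= inE eqxx in u.
  case: q u uc gq => //= y q u uc; rewrite inE negb_or => /andP[gy _].
  by rewrite (@incidentI _ _ _ c) ?set21 //; apply: trail_path; exact: uc.
by rewrite /= gq trail_uniq.
Qed.

Lemma uniq_weave (T : eqType) (e f g : T) (A B S : seq T) :
  uniq (A ++ f :: B) -> e \notin A ++ f :: B -> g \notin f :: A -> g != e -> uniq S ->
  {subset S <= g :: B} -> uniq (f :: (e :: A) ++ S).
Proof.
rewrite -cat1s uniq_catCA cat_uniq => /and3P[_ fAB uAB].
rewrite mem_cat inE !negb_or => /and3P[eA ef eB] /andP[gf gA] ge uS sub.
move: uAB; rewrite cat_uniq => /and3P[uA /hasPn dAB uB].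
have fA : f \notin A by apply: contra fAB => fA; apply/hasP; exists f; rewrite ?mem_cat ?fA ?inE.
have fB : f \notin B.
  by apply: contra fAB => fB; apply/hasP; exists f; rewrite ?mem_cat ?fB ?orbT ?inE.
have nS z : z != g -> z \notin B -> z \notin S.
  by move=> zg zB; apply/negP => /sub; rewrite inE (negPf zg) (negPf zB).
rewrite cons_uniq mem_cat inE !negb_or eq_sym ef fA nS 1?eq_sym //= mem_cat negb_or eA.
rewrite nS 1?eq_sym //= cat_uniq uA uS andbT /=; apply/hasPn => z /sub.
by rewrite inE => /orP[/eqP->//|]; exact: dAB.
Qed.

(** The [P_n] through [wb] and [bc] avoids the edge [ba], which can be inserted between [bc] and
    [bw], all three meeting at [b]. This makes up for the edge missing when [cd] already lies on
    that path. *)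
Lemma HL_paired_branch n (X : sgraph) (F E D : HL n X) (a b c d w : X) :
  full n X -> 3 <= n -> val F = [set b; c] -> val E = [set b; a] -> val D = [set c; d] ->
  adj b w -> w != a -> w != c -> a != c -> d != b -> paired n F E D.
Proof.
move=> fX n3 VF VE VD bw wa wc ac db.
have bc : adj b c by rewrite -edgesE -VF (valP F).
have ba : adj b a by rewrite -edgesE -VE (valP E).
have [p [q [[up uq sz] [bp bq] [wq cp] [eP eQ] uPQ]]] := paired_trail (fX _ _ _ bw bc wc).
have [s [ps us ss zs]] := trail_detour uq db.
apply: (@HL_pairedI _ _ _ _ _ (trail b (w :: p)) s) => //.
- rewrite VF VE VD; apply: (uniq_weave uPQ) ss => //.
  + rewrite mem_cat negb_or; apply/andP; split; apply/negP => h.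
      have := trail_head up h (set21 _ _) => /eqP.
      rewrite eq_set2 eqxx [a == w]eq_sym (negPf wa) /= => /andP[/eqP bw' _].
      by rewrite bw' adj_irrefl in bw.
    have := trail_head uq h (set21 _ _) => /eqP.
    by rewrite eq_set2 eqxx (negPf ac) /= => /andP[/eqP bc' _]; rewrite bc' adj_irrefl in bc.
  + rewrite in_cons negb_or; apply/andP; split.
      rewrite eq_set2 (negPf db) andbF orbF.
      by apply/negP => /andP[/eqP cb _]; rewrite cb adj_irrefl in bc.
    apply/negP => /mem_trail/(_ c (set21 _ _)); rewrite inE (negPf cp) orbF => /eqP cb.
    by rewrite cb adj_irrefl in bc.
  + rewrite eq_set2 (negPf db) andbF orbF.
    by apply/negP => /andP[/eqP cb _]; rewrite cb adj_irrefl in bc.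
- move=> z zs'; have := ss z; rewrite [z \in _ :: s]inE zs' orbT => /(_ isT).
  rewrite inE => /orP[/eqP->|zq]; first by rewrite -VD (valP D).
  by apply: eQ; rewrite inE zq orbT.
- rewrite VF VE; have bwt := trail_path up.
  rewrite [trail b _]/= /= bwt andbT !(@incidentI _ _ _ b) ?set21 //.
    rewrite eq_set2 eqxx [a == w]eq_sym (negPf wa) /=.
    by apply/negP => /andP[/eqP bw' _]; rewrite bw' adj_irrefl in bw.
  rewrite eq_set2 eqxx [c == a]eq_sym (negPf ac) /=.
  by apply/negP => /andP[/eqP ba' _]; rewrite ba' adj_irrefl in ba.
- by rewrite VF VD.
rewrite [size (_ :: _)]/= size_trail sz; move: (_ \in trail c q) zs => m; clear; lia.
Qed.

Lemma connected_leave (X : sgraph) (P : pred X) x y : connected X -> P x -> ~~ P y ->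
  exists u v, [/\ adj u v, P u & ~~ P v].
Proof.
case/andP=> _ /forallP/(_ x)/forallP/(_ y)/connectP[p]; elim: p x => [|z p IH] x /=.
  by move=> _ -> ->.
case/andP=> xz pp ly Px nPy; have [Pz|nPz] := boolP (P z); first exact: IH pp ly Pz nPy.
by exists x, z.
Qed.

(* With [f] the middle edge: if [e] and [d] share an end, insert [f] into a path through them;
   otherwise lengthen the path through [e], [f] by an edge [h] leaving it, which breaks the
   sequence [e], [f], [d] only if [h] is attached at an end of [f]. *)
Lemma HL_full n (X : sgraph) : 3 <= n -> full n X -> connected (HL n X) ->
  n <= #|edges X| -> full n (HL n X).
Proof.
move=> n3 fX cX nE F E D FE FD ED.
have share (A : HL n X) : adj F A -> (val A != val F) /\ exists2 u, u \in val F & u \in val A.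
  case/and3P=> FA /set0Pn[u]; rewrite inE => /andP[uF uA] _.
  by split; [rewrite eq_sym | exists u].
have [EF [b bF bE]] := share E FE; have [DF [c cF cD]] := share D FD.
have {}ED : val E != val D by apply: contraNneq ED => /val_inj->.
have [|dj] := boolP (val E :&: val D != set0).
  case/set0Pn=> v; rewrite inE => /andP[vE vD].
  have [x vx Ex] := edges_at (valP E) vE; have [y vy Dy] := edges_at (valP D) vD.
  have xy : x != y by apply: contraNneq ED => xy; rewrite Ex Dy xy.
  have [p [q [[up uq sz] [vp vq] [xq yp] [eP eQ] uPQ]]] := paired_trail (fX _ _ _ vx vy xy).
  have tp := trail_path up; have tq := trail_path uq.
  apply: (@HL_pairedI _ _ _ _ _ (trail x p) (trail y q)) => //.
  (* [F] meets both [E] and [D], while each arm contains only one of [x] and [y]. So if [F] were on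
     an arm it would contain [v] and be [E] or [D]. *)
  - rewrite Ex Dy -[_ :: trail x p]/(trail v (x :: p)) -[_ :: trail y q]/(trail v (y :: q)).
    rewrite cons_uniq uPQ andbT mem_cat negb_or; apply/andP; split; apply/negP => h.
      have cv : c = v.
        move: cD; rewrite Dy !inE => /orP[/eqP//|/eqP cy].
        by have := mem_trail h cF; rewrite inE => /orP[/eqP//|]; rewrite cy (negPf yp).
      by rewrite cv in cF; rewrite (trail_head up h cF) Ex eqxx in EF.
    have bv : b = v.
      move: bE; rewrite Ex !inE => /orP[/eqP//|/eqP bx].
      by have := mem_trail h bF; rewrite inE => /orP[/eqP//|]; rewrite bx (negPf xq).
    by rewrite bv in bF; rewrite (trail_head uq h bF) Dy eqxx in DF.
  - by move=> z zp; apply: eP; rewrite inE zp orbT.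
  - by move=> z zq; apply: eQ; rewrite inE zq orbT.
  - by rewrite /= (@incidentI _ _ _ b) 1?eq_sym //= Ex.
  - by rewrite /= (@incidentI _ _ _ c) 1?eq_sym //= Dy.
  - by rewrite !size_trail sz.
move: dj; rewrite negbK => /eqP dj.
have nED u : u \in val E -> u \in val D -> False.
  by move=> uE uD; have := in_set0 u; rewrite -dj inE uE uD.
have [a ba VE] := edges_at (valP E) bE; have [d cd VD] := edges_at (valP D) cD.
have bc : b != c by apply/eqP => bc; apply: (nED b) => //; rewrite bc.
have VF : val F = [set b; c].
  have [z bz VF] := edges_at (valP F) bF.
  by move: cF; rewrite VF !inE eq_sym (negPf bc) => /eqP->.
have adbc : adj b c by rewrite -edgesE -VF (valP F).
have ac : a != c by apply/eqP => E'; apply: (nED c) => //; rewrite VE -E' set22.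
have db : d != b by apply/eqP => E'; apply: (nED b) => //; rewrite VD -E' set22.
have [p [q [[up uq sz] [bp bq] [aq cp] [eP eQ] uPQ]]] := paired_trail (fX _ _ _ ba adbc ac).
have uP : uniq (trail a p ++ [set b; c] :: trail c q) /\
    [set b; a] \notin trail a p ++ [set b; c] :: trail c q.
  by move: uPQ => /= /andP[? ?].
have gA : [set c; d] \notin [set b; c] :: trail a p.
  rewrite in_cons negb_or eq_set2 (negPf db) andbF orbF [c == b]eq_sym (negPf bc) /=.
  by apply/negP => /mem_trail/(_ c (set21 _ _)); rewrite (negPf cp).
have ge : [set c; d] != [set b; a] by rewrite -VE -VD eq_sym.
have pA := trail_path up.
have incFE : incident (val F) (val E) by rewrite (@incidentI _ _ _ b) // eq_sym.
have [s [ps us ss zs]] := trail_detour uq db.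
have eA : {subset trail a p <= edges X} by move=> z zp; apply: eP; rewrite inE zp orbT.
have eS : {subset s <= edges X}.
  move=> z zs'; have := ss z; rewrite [z \in _ :: s]inE zs' orbT => /(_ isT).
  rewrite inE => /orP[/eqP->|zq]; first by rewrite -VD (valP D).
  by apply: eQ; rewrite inE zq orbT.
have [gq|gq] := boolP ([set c; d] \in trail c q); last first.
  apply: (@HL_pairedI _ _ _ _ _ (trail a p) s) => //.
  - by rewrite VF VE VD; apply: (uniq_weave uP.1 uP.2) ss.
  - by rewrite /= incFE VE.
  - by rewrite VF VD.
  - by move: zs; rewrite size_trail (negPf gq) sz; clear; lia.
case: q uq sz bq aq eQ uPQ uP gq {s ps us ss zs eS} => // d' q uq sz bq aq eQ uPQ uP gq.
have ucq : uniq (c :: d' :: q) by case/andP: uq.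
have := trail_head ucq gq (set21 _ _) => /eqP; rewrite eq_set2 eqxx /=.
move=> dd'; have {dd'} dd : d' = d.
  case/orP: dd' => [/eqP->//|/andP[/eqP cd' /eqP dc]].
  by rewrite dc adj_irrefl in cd.
rewrite {}dd in uq sz bq aq eQ uPQ uP gq ucq.
(* [W] has [n - 1] elements, so some edge of [X] lies outside it, and by connectedness of [HL n X]
   there is such an edge meeting an edge of [W]. *)
pose W := trail b (a :: p) ++ trail b (c :: d :: q).
have [h [u [hE hW [G0 [G0W uG uh]]]]] : exists h u, [/\ h \in edges X, h \notin W &
    exists G0, [/\ G0 \in W, u \in G0 & u \in h]].
  have [y yW] : exists y : HL n X, val y \notin W.
    case: (pickP (fun y : HL n X => val y \notin W)) => [y yW|no]; first by exists y.
    have sub : edges X \subset W.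
      by apply/subsetP => e eE; have := no (exist _ e eE) => /negbFE.
    have := leq_trans nE (leq_trans (subset_leq_card sub) (card_size W)).
    rewrite size_cat !size_trail sz /=; clear; lia.
  have FW : val F \in W by rewrite VF /W mem_cat orbC /= inE eqxx.
  have [z [t [zt zW tW]]] := connected_leave (P := fun z : HL n X => val z \in W) cX FW yW.
  case/and3P: zt => _ /set0Pn[u]; rewrite inE => /andP[uz ut] _.
  by exists (val t), u; split=> //; [exact: valP | exists (val z)].
move: hW; rewrite mem_cat negb_or => /andP[hP hQ].
have uW : u \in [:: b, c & a :: p] ++ d :: q.
  move: G0W; rewrite mem_cat => /orP[] /mem_trail/(_ u uG); rewrite !inE mem_cat !inE.
    by case/or3P=> ->; rewrite ?orbT.
  by case/or4P=> ->; rewrite ?orbT.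
have pB := trail_path ucq.
have incFD : incident (val F) (val D) by rewrite (@incidentI _ _ _ c) // eq_sym.
have eB : {subset trail d q <= edges X}.
  by move=> z zq; apply: eQ; rewrite !inE zq !orbT.
have uF : uniq (val F :: (val E :: trail a p) ++ val D :: trail d q).
  rewrite VF VE VD -[_ :: trail d q]/(trail c (d :: q)).
  apply: (uniq_weave uP.1 uP.2 gA ge) => //.
    exact: trail_uniq.
  by move=> z; rewrite inE orbC => ->.
have hN : h \notin val F :: (val E :: trail a p) ++ val D :: trail d q.
  move: hP hQ; rewrite VF VE VD !inE !mem_cat !inE !negb_or.
  by move=> /andP[-> ->] /and3P[-> -> ->].
move: uW; rewrite mem_cat [u \in [:: b, c & _]]in_cons [u \in c :: _]in_cons.
case/orP=> [/or3P[/eqP ub|/eqP uc|ua]|ud].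
- rewrite {}ub in uh uG; have [w bw Eh] := edges_at hE uh.
  apply: (HL_paired_branch fX n3 VF VE VD bw) => //.
    by apply: contraNneq hN => wa; rewrite VE Eh wa !inE eqxx orbT.
  by apply: contraNneq hN => wc; rewrite VF Eh wc !inE eqxx.
- rewrite {}uc in uh uG; have [w cw Eh] := edges_at hE uh.
  apply: paired_sym; rewrite setUC in VF.
  apply: (HL_paired_branch fX n3 VF VD VE cw) => //.
    by apply: contraNneq hN => wd; rewrite VD Eh wd !inE !mem_cat !inE eqxx !orbT.
  by apply: contraNneq hN => wb; rewrite VF Eh wb !inE eqxx.
- have [s ps es] := insert_trail up ua uh hP.
  apply: (@HL_pairedI _ _ _ _ _ s (trail d q)) => //.
  + rewrite (perm_uniq (_ : perm_eq _ (h :: val F :: (val E :: trail a p) ++ val D :: trail d q))).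
      by rewrite cons_uniq hN uF.
    by apply/permP => P; have := permP es P; rewrite /= !count_cat /=; clear; lia.
  + by move=> z; rewrite (perm_mem es) inE => /orP[/eqP->|/eA].
  + by rewrite /= incFE VE.
  + by rewrite /= incFD VD.
  + by rewrite (perm_size es) /= !size_trail sz /=; clear; lia.
have [|s ps es] := insert_trail ucq ud uh.
  by move: hQ; rewrite [_ \in trail b _]inE negb_or => /andP[].
apply: (@HL_pairedI _ _ _ _ _ (trail a p) s) => //.
+ rewrite (perm_uniq (_ : perm_eq _ (h :: val F :: (val E :: trail a p) ++ val D :: trail d q))).
    by rewrite cons_uniq hN uF.
  by apply/permP => P; have := permP es P; rewrite /= !count_cat /=; clear; lia.
+ by move=> z; rewrite (perm_mem es) inE => /orP[/eqP->|/eB].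
+ by rewrite /= incFE VE.
+ by rewrite /= incFD VD.
+ by rewrite (perm_size es) /= !size_trail sz /=; clear; lia.
Qed.

(** * Growth *)

Lemma full_narcs_link n (X : sgraph) (v : X) : full n X ->
  narcs (link n v) = #|nbrs v| * #|nbrs v|.-1.
Proof.
move=> fX; rewrite narcs_sum (bigID (mem (nbrs v))) /= [X in _ + X]big1 ?addn0.
  rewrite -sum_nat_const; apply: eq_bigr => x vx; rewrite (cardsD1 x (nbrs v)) vx /=.
  apply: eq_card => y; rewrite !inE; rewrite inE in vx.
  apply/idP/andP => [l|[xy vy]]; last by apply/linkP; apply: fX; rewrite // eq_sym.
  by rewrite eq_sym (link_neq l); case/and3P: l.
move=> x; rewrite inE => /negPf nx; apply/eqP; rewrite cards_eq0; apply/eqP/setP => y.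
by rewrite !inE /link nx.
Qed.

(* [(d - 2)^2] with truncated subtraction, from [d (d - 1) + 4 = 3 d + (d - 2)^2]. *)
Lemma narcs_HL_full n (X : sgraph) : full n X ->
  narcs (@adj (HL n X)) + 4 * #|X| = 3 * narcs (@adj X) +
    \sum_(v : X) (#|nbrs v| - 2 + (2 - #|nbrs v|)) ^ 2.
Proof.
move=> fX; rewrite narcs_HL narcs_sum big_distrr /= -big_split /=.
rewrite (_ : 4 * #|X| = \sum_(v : X) 4) -?big_split; last by rewrite sum_nat_const mulnC.
apply: eq_bigr => v _; rewrite (full_narcs_link v fX).
rewrite -[#|[set x | adj v x]|]/#|nbrs v|; case: #|nbrs v| => [|[|m]] //=.
by rewrite subSS subSS subn0 subSS subSS sub0n; nia.
Qed.

Lemma leq_narcs_HL_full n (X : sgraph) (v : X) : full n X ->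
  3 * narcs (@adj X) + (#|nbrs v| - 2 + (2 - #|nbrs v|)) ^ 2
    <= narcs (@adj (HL n X)) + 4 * #|X|.
Proof. by move/narcs_HL_full->; rewrite leq_add2l (bigD1 v) //= leq_addr. Qed.

Lemma narcs_card_HL n (X : sgraph) : narcs (@adj X) = 2 * #|HL n X|.
Proof. by rewrite card_HL narcs_edges. Qed.

Lemma full_connect n (X : sgraph) (E F : HL n X) (x y : X) : full n X ->
  connect (@adj X) x y -> x \in val E -> y \in val F -> connect (@adj (HL n X)) E F.
Proof.
move=> fX; have near (A B : HL n X) u : u \in val A -> u \in val B ->
    connect (@adj (HL n X)) A B.
  move=> uA uB; have [->|AB] := eqVneq A B; first exact: connect0.
  apply/connect1/(full_incident fX (valP A) (valP B)).
  by apply: incidentI uA uB; apply: contraNneq AB => /val_inj->.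
case/connectP=> p; elim: p x E => [|z p IH] x E /=; first by move=> _ -> xE xF; exact: near xE xF.
case/andP=> xz pp ly xE yF; have eE : [set x; z] \in edges X by rewrite edgesE.
pose A : HL n X := exist (fun e => e \in edges X) _ eE.
apply: connect_trans (near E A x xE (set21 _ _)) _.
exact: (IH z A pp ly (set22 _ _) yF).
Qed.

Lemma HL_connected n (X : sgraph) : full n X -> connected X -> 0 < #|edges X| ->
  connected (HL n X).
Proof.
move=> fX /andP[_ /forallP cX] e0; rewrite /connected card_HL e0 /=.
apply/forallP => E; apply/forallP => F.
have /edgesP[x [? [_ Ex]]] := valP E; have /edgesP[y [? [_ Fy]]] := valP F.
apply: (full_connect fX (forallP (cX x) y)); first by rewrite Ex set21.
by rewrite Fy set21.
Qed.

(** The invariant under which [HL] goes on being the line graph operator. Connectedness is asked of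
    [HL n X] because [X] may have isolated vertices, as a graph [restr F] can. *)
Definition spread n (X : sgraph) := [/\ full n X, connected (HL n X) & n <= #|edges X|].

Lemma spread_HL n (X : sgraph) : 3 <= n -> spread n X ->
  2 * #|HL n X| <= narcs (@adj (HL n X)) -> spread n (HL n X).
Proof.
move=> n3 [fX cX eX] le; have fH := HL_full n3 fX cX eX.
have nE : n <= #|edges (HL n X)|.
  by rewrite card_HL narcs_edges leq_mul2l /= in le; exact: leq_trans le.
by split=> //; apply: HL_connected => //; apply: leq_trans nE; exact: leq_trans n3.
Qed.

Definition unbounded n (X : sgraph) := forall B, exists k, B <= #|HL_iter n k X|.

(** By [narcs_HL_full] the next graph has at least [3 * narcs (@adj X) - 4 * #|X|] arcs, more than
    [narcs (@adj X)], which is twice its number of vertices. So the excess of edges persists and the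
    vertices increase at every step. *)
Lemma spread_unbounded n (X : sgraph) : 3 <= n -> spread n X ->
  2 * #|X| < narcs (@adj X) -> unbounded n X.
Proof.
move=> n3 sX lt B; exists B.
suff: [/\ spread n (HL_iter n B X), 2 * #|HL_iter n B X| < narcs (@adj (HL_iter n B X))
    & B <= #|HL_iter n B X|] by case.
elim: B => [|B [sB ltB leB]] //=; set Z := HL_iter n B X in sB ltB leB *.
have grow : 2 * #|HL n Z| < narcs (@adj (HL n Z)).
  have [fZ _ _] := sB; have := narcs_HL_full fZ; rewrite (narcs_card_HL n Z) in ltB *; lia.
split=> //; first by apply: spread_HL => //; exact: ltnW.
by rewrite (narcs_card_HL n Z) ltn_mul2l in ltB; exact: leq_ltn_trans ltB.
Qed.

Lemma unbounded_HL n (X : sgraph) : unbounded n (HL n X) -> unbounded n X.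
Proof. by move=> uH B; have [k le] := uH B; exists k.+1; rewrite HL_iterS. Qed.

Lemma unbounded_emb n (X Y : sgraph) : emb X Y -> unbounded n X -> unbounded n Y.
Proof.
move=> e uX B; have [k le] := uX B; exists k; apply: leq_trans le _.
exact/emb_card/emb_HL_iter.
Qed.

(** In [HL n X] the edges [vx], [vy], [vz] form a triangle, so there are at least as many edges as
    vertices, and [vx] has the third neighbour [xt]. Its degree makes the square term of
    [leq_narcs_HL_full] positive, so one step later edges outnumber vertices. *)
Lemma spread_claw_unbounded n (X : sgraph) (v x y z t : X) : 3 <= n -> spread n X ->
  adj v x -> adj v y -> adj v z -> uniq [:: x; y; z] -> adj x t -> t != v -> unbounded n X.
Proof.
move=> n3 sX vx vy vz u xt tv; have [fX cX eX] := sX.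
have ed a b : adj a b -> [set a; b] \in edges X by rewrite edgesE.
pose E a b (h : adj a b) : HL n X := exist (fun e => e \in edges X) _ (ed _ _ h).
have adE (A D : HL n X) w : w \in val A -> w \in val D -> A != D -> adj A D.
  move=> wA wD AD; apply: (full_incident fX (valP A) (valP D)).
  by apply: incidentI wA wD; apply: contraNneq AD => /val_inj->.
have neE a b c (hb : adj a b) (hc : adj a c) : b != c -> E _ _ hb != E _ _ hc.
  move=> bc; rewrite -val_eqE /= eq_set2 eqxx (negPf bc) /=.
  by apply/negP => /andP[_ /eqP ba]; rewrite ba adj_irrefl in hb.
have xv : adj x v by rewrite adj_sym.
have Exv : E _ _ xv = E _ _ vx by apply: val_inj; rewrite /= setUC.
move: u; rewrite /= !inE negb_or !andbT => /andP[/andP[xy xz] yz].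
pose Z := HL n X.
have aXY : adj (E _ _ vx : Z) (E _ _ vy) by rewrite (adE _ _ v) ?neE ?set21.
have aYZ : adj (E _ _ vy : Z) (E _ _ vz) by rewrite (adE _ _ v) ?neE ?set21.
have aXZ : adj (E _ _ vx : Z) (E _ _ vz) by rewrite (adE _ _ v) ?neE ?set21.
have Z0 : 2 * #|Z| <= narcs (@adj Z).
  have u : uniq [:: E _ _ vx; E _ _ vy; E _ _ vz] by rewrite /= !inE negb_or !neE.
  have c : cycle (@adj Z) [:: E _ _ vx; E _ _ vy; E _ _ vz].
    by apply/and4P; split; rewrite // (adj_sym (E _ _ vz)).
  have := leq_ncomp_cycle (@adj_sym Z) (@adj_irrefl Z) u isT c.
  by rewrite ncomp_connected //; clear; lia.
have sZ : spread n Z by exact: spread_HL.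
have [fZ _ _] := sZ; have := leq_narcs_HL_full (E _ _ vx : Z) fZ.
have : 2 < #|nbrs (E _ _ vx : Z)|.
  apply/card_geqP; exists [:: E _ _ vy; E _ _ vz; E _ _ xt]; split=> //.
    have nxt a (va : adj v a) : E _ _ va != E _ _ xt.
      by rewrite -val_eqE /= eq_set2 (negPf (adj_neq vx)) [v == t]eq_sym (negPf tv).
    by rewrite /= !inE negb_or !neE ?nxt.
  move=> A; rewrite !inE => /or3P[]/eqP-> //.
  rewrite (adE _ _ x) ?set21 ?set22 // -val_eqE /= eq_set2 (negPf (adj_neq vx)) /=.
  by rewrite [v == t]eq_sym (negPf tv).
rewrite (narcs_card_HL n Z) => dE EZ.
have Z1 : 2 * #|HL n Z| < narcs (@adj (HL n Z)).
  have sq d : 2 < d -> 0 < (d - 2 + (2 - d)) ^ 2 by rewrite expn_gt0; lia.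
  rewrite (narcs_card_HL n Z) in Z0; move: (sq _ dE) Z0 EZ; clear; lia.
apply/unbounded_HL/unbounded_HL/(spread_unbounded n3 _ Z1).
by apply: spread_HL => //; exact: ltnW.
Qed.

(** * Spiders *)

(** The two arms form one path with at least [n] vertices. Its marked vertex [v] is shifted along
    [p] until it reaches [c]; there the path edges are the first edges of the two arms. *)
Lemma arms_incident n (X : sgraph) (v c a b : X) (p q : seq X) : 3 <= n ->
  uniq (v :: p ++ q) -> path (@adj X) v p -> path (@adj X) v q ->
  n <= size p + size q + 1 -> c = v \/ c \in p ->
  [set c; a] \in trail v p ++ trail v q -> [set c; b] \in trail v p ++ trail v q ->
  a != b -> paired n c a b.
Proof.
move=> n3; elim: p v q => [|x p IH] v q u pp pq le cp ca cb ab.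
  case: cp => // cv; rewrite {}cv in ca cb *; case: q u pq le ca cb => // y q u _ _ ca cb.
  have := trail_head u ca (set21 _ _) => /eqP.
  rewrite -(trail_head u cb (set21 _ _)) eq_set2 eqxx (negPf ab) /=.
  by case/andP=> /eqP vb /eqP av; rewrite av vb eqxx in ab.
have [cv|cv] := eqVneq c v.
  rewrite {}cv in ca cb *.
  have [vp vq] : v \notin x :: p /\ v \notin q.
    by move: u; rewrite cons_uniq mem_cat negb_or => /andP[/andP[]].
  have up : uniq (v :: x :: p).
    by move: u; rewrite cons_uniq cat_uniq => /andP[_ /andP[ux _]]; rewrite cons_uniq vp.
  have uq : uniq (v :: q).
    by move: u; rewrite cons_uniq cat_uniq => /andP[_ /and3P[_ _ ux]]; rewrite cons_uniq vq.
  have hd w d s : adj v w -> uniq (v :: w :: s) -> [set v; d] \in trail v (w :: s) -> d = w.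
    move=> vw us /(trail_head us)/(_ (set21 _ _))/eqP; rewrite eq_set2 eqxx /=.
    by case/orP=> [/eqP//|/andP[/eqP E _]]; rewrite E adj_irrefl in vw.
  have vx : adj v x by case/andP: pp.
  have cross d : [set v; d] \in trail v (x :: p) ++ trail v q ->
      d = x \/ exists q', q = d :: q'.
    rewrite mem_cat => /orP[/(hd _ _ _ vx up)|]; first by left.
    case: q uq pq {u le ca cb vq} => // y q uq /andP[vy _] /(hd _ _ _ vy uq) <-.
    by right; exists q.
  case: (cross a ca) (cross b cb) => [ax|[q1 Eq]] [bx|[q2 Eq']].
  - by rewrite ax bx eqxx in ab.
  - rewrite ax Eq' in u pq le *; apply: (paired_leq n3 u pp pq).
    by move: le => /=; clear; lia.
  - rewrite bx Eq in u pq le *; apply: paired_sym; apply: (paired_leq n3 u pp pq).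
    by move: le => /=; clear; lia.
  - by move: Eq'; rewrite Eq => -[E _]; rewrite E eqxx in ab.
have cxp : c \in x :: p by case: cp => // E; rewrite E eqxx in cv.
case/andP: pp => vx pp.
apply: (IH x (v :: q)) => //.
- rewrite (perm_uniq (_ : perm_eq _ (v :: (x :: p) ++ q))) //.
  by apply/permP => P; rewrite /= !count_cat /=; clear; lia.
- by rewrite /= adj_sym vx.
- by move: le => /=; clear; lia.
- by move: cxp; rewrite inE => /orP[/eqP|]; [left | right].
- by move: ca; rewrite !mem_cat !inE setUC [[set v; x]]setUC orbCA orbA.
- by move: cb; rewrite !mem_cat !inE [[set v; x]]setUC orbCA orbA.
Qed.

Lemma restr_trail (X : sgraph) (F : {set {set X}}) (v : X) p : path (@adj X) v p ->
  {subset trail v p <= F} -> path (@adj (restr F)) v p.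
Proof.
elim: p v => //= x p IH v /andP[vx pp] sub; rewrite /restr_adj vx sub ?inE ?eqxx //=.
by apply: IH => // e ep; apply: sub; rewrite inE ep orbT.
Qed.

(** The legs are longest arms, so by [link_depth] any two of them form a path on at least [n]
    vertices. Two incident edges of the spider lie on two of its legs, so the spider is full. *)
Lemma spider_unbounded n (X : sgraph) (v x y z : X) : 4 <= n -> uniq [:: x; y; z] ->
  link n v x y -> link n v y z -> link n v x z -> ~~ connect (away v) x y ->
  ~~ connect (away v) y z -> ~~ connect (away v) x z -> unbounded n X.
Proof.
move=> n4 u3 lxy lyz lxz nxy nyz nxz; have n3 : 3 <= n by exact: ltnW.
have [vx [vy vz]] : adj v x /\ adj v y /\ adj v z.
  by case/and3P: lxy => -> -> _; case/and3P: lyz => _ -> _.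
have [p ap sp] := depth_arm vx; have [q aq sq] := depth_arm vy.
have [r ar sr] := depth_arm vz.
have uxy := arm_cat_uniq ap aq nxy; have uyz := arm_cat_uniq aq ar nyz.
have uxz := arm_cat_uniq ap ar nxz.
have [dxy [dyz dxz]] : n <= size p + size q + 3 /\
    n <= size q + size r + 3 /\ n <= size p + size r + 3.
  by rewrite sp sq sr !link_depth.
have [vp pp] := andP ap; have [vq pq] := andP aq; have [vr pr] := andP ar.
pose F : {set {set X}} :=
  [set e in trail v (x :: p) ++ trail v (y :: q) ++ trail v (z :: r)].
pose Y := restr F.
have FE e : (e \in F) =
    [|| e \in trail v (x :: p), e \in trail v (y :: q) | e \in trail v (z :: r)].
  by rewrite in_set !mem_cat.
have sP : {subset trail v (x :: p) <= F} by move=> e; rewrite FE => ->.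
have sQ : {subset trail v (y :: q) <= F} by move=> e; rewrite FE => ->; rewrite orbT.
have sR : {subset trail v (z :: r) <= F} by move=> e; rewrite FE => ->; rewrite !orbT.
have ppY := restr_trail pp sP; have pqY := restr_trail pq sQ; have prY := restr_trail pr sR.
have pairF (s t : seq X) : uniq (v :: s ++ t) -> path (@adj Y) v s -> path (@adj Y) v t ->
    n <= size s + size t + 1 -> forall c a b : Y, a != b ->
    [set c; a] \in trail v s ++ trail v t -> [set c; b] \in trail v s ++ trail v t ->
    paired (G := Y) n c a b.
  move=> u ps pt le c a b ab ca cb.
  have [cs|ct] : (c = v \/ c \in s) \/ (c = v \/ c \in t).
    move: ca; rewrite mem_cat => /orP[] /mem_trail/(_ c (set21 _ _)); rewrite inE.
      by case/orP=> [/eqP|]; left; [left | right].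
    by case/orP=> [/eqP|]; right; [left | right].
    exact: (arms_incident (X := Y) n3 u ps pt le cs ca cb ab).
  apply: (arms_incident (X := Y) (v := v) (p := t) (q := s) n3 _ pt ps _ ct _ _ ab).
  - by rewrite (perm_uniq (_ : perm_eq _ (v :: s ++ t))) // perm_cons perm_catC.
  - by rewrite (addnC (size t)).
  - by rewrite mem_cat orbC -mem_cat.
  - by rewrite mem_cat orbC -mem_cat.
have d1 (s t : seq X) (w w' : X) : n <= size s + size t + 3 ->
    n <= size (w :: s) + size (w' :: t) + 1 by move=> /=; clear; lia.
have Kxy := pairF _ _ uxy ppY pqY (d1 _ _ x y dxy).
have Kyz := pairF _ _ uyz pqY prY (d1 _ _ y z dyz).
have Kxz := pairF _ _ uxz ppY prY (d1 _ _ x z dxz).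
have fY : full n Y.
  move=> c a b /andP[_ +] /andP[_ +] ab; rewrite !FE.
  case/or3P=> ca /or3P[] cb; [apply: Kxy | apply: Kxy | apply: Kxz
    | apply: Kxy | apply: Kxy | apply: Kyz | apply: Kxz | apply: Kyz | apply: Kxz];
    by rewrite // mem_cat ?ca ?cb ?orbT.
have eY : edges Y = F.
  rewrite /Y restr_edges; apply/setIidPr/subsetP => e; rewrite inE !mem_cat.
  by case/or3P; apply: trail_edges.
have nY : n <= #|edges Y|.
  (* Two legs are only guaranteed [n - 1] edges; the first edge of the third leg is the one still
     needed. *)
  have uu : uniq ([set v; z] :: trail v (x :: p) ++ trail v (y :: q)).
    rewrite cons_uniq trail_cat_uniq // ?andbT; last first.
      by move=> e /(trail_edges pp); exact: card_edge.
    apply/negP; rewrite mem_cat => /orP[] /mem_trail/(_ z (set22 _ _)); rewrite in_cons.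
      case/orP=> [/eqP zv|zp]; first by rewrite zv adj_irrefl in vz.
      move: uxz; rewrite cons_uniq cat_uniq => /andP[_ /and3P[_ /hasPn/(_ z) h _]].
      by case/negP: (h (mem_head _ _)).
    case/orP=> [/eqP zv|zp]; first by rewrite zv adj_irrefl in vz.
    move: uyz; rewrite cons_uniq cat_uniq => /andP[_ /and3P[_ /hasPn/(_ z) h _]].
    by case/negP: (h (mem_head _ _)).
  apply: leq_trans dxy _; rewrite eY.
  have -> : size p + size q + 3 = size ([set v; z] :: trail v (x :: p) ++ trail v (y :: q)).
    by rewrite /= size_cat /= !size_trail; clear; lia.
  rewrite -(card_uniqP uu); apply: subset_leq_card; apply/subsetP => e.
  rewrite in_cons => /orP[/eqP->|]; first by apply: sR; rewrite inE eqxx.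
  by rewrite mem_cat => /orP[/sP|/sQ].
have vF e u : e \in F -> u \in e -> connect (@adj Y) v u.
  rewrite FE => /or3P[] /mem_trail sub /sub ue.
  - exact: path_connect ppY _ ue.
  - exact: path_connect pqY _ ue.
  - exact: path_connect prY _ ue.
have cY : connected (HL n Y).
  rewrite /connected card_HL (leq_trans _ nY) ?(ltnW (ltnW n3)) //=.
  have sc := sym_connect_sym (@adj_sym Y).
  apply/forallP => E; apply/forallP => D.
  have EF : (val E : {set X}) \in F by rewrite -eY (valP E).
  have DF : (val D : {set X}) \in F by rewrite -eY (valP D).
  have [a [a' [_ Ea]]] := elimT (edgesP (G := Y) (val E)) (valP E).
  have [b [b' [_ Db]]] := elimT (edgesP (G := Y) (val D)) (valP D).
  have aE : a \in val E by rewrite Ea set21.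
  have bD : b \in val D by rewrite Db set21.
  apply: (full_connect fY _ aE bD); apply: connect_trans (vF _ _ DF bD).
  by rewrite sc; exact: vF EF aE.
have sY : spread n Y by [].
have vxY : adj (v : Y) x by case/andP: ppY.
have vyY : adj (v : Y) y by case/andP: pqY.
have vzY : adj (v : Y) z by case/andP: prY.
have YX : emb Y X by exists id => // a b /andP[].
apply: unbounded_emb YX _.
have step (w : X) (s : seq X) : path (@adj Y) v (w :: s) -> uniq (v :: w :: s) ->
    0 < size s -> exists2 t, adj (w : Y) t & t != v.
  case: s => // t s /and3P[_ wt _] /andP[vs _] _; exists t => //.
  by apply: contraNneq vs => <-; rewrite !inE eqxx orbT.
(* Here [4 <= n] enters: if the leg at [x] is a single edge, the leg at [y] has a second one. *)
have [p0|p0] := posnP (size p); last first.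
  have [t xt tv] := step _ _ ppY vp p0.
  exact: (spread_claw_unbounded n3 sY vxY vyY vzY u3 xt tv).
have [t yt tv] : exists2 t, adj (y : Y) t & t != v.
  by apply: step pqY vq _; move: dxy n4; rewrite p0; clear; lia.
apply: (spread_claw_unbounded n3 sY vyY vxY vzY _ yt tv).
by move: u3; rewrite /= !inE !negb_or eq_sym => /and3P[/andP[-> ->] -> _].
Qed.

(** * Forests *)

Lemma acyclic_away (X : sgraph) (v x y : X) : acyclic (@adj X) -> adj v x -> adj v y ->
  connect (away v) x y -> x = y.
Proof.
move=> ac vx vy c; apply/eqP/negPn/negP => xy.
by have [s [us ss cs _ _]] := away_cycle vx vy xy c; exact: (ac s).
Qed.

Lemma acyclic_emb (X Y : sgraph) : emb X Y -> acyclic (@adj Y) -> acyclic (@adj X).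
Proof.
case=> f fi fh ac s us ss cs; apply: (ac (map f s)); rewrite ?map_inj_uniq ?size_map //.
exact: homo_cycle fh _ cs.
Qed.

(** Four consecutive vertices of a cycle would give a chord by [link_chord], and the chord closes a
    triangle. *)
Lemma acyclic_link n (X : sgraph) (v : X) : 3 <= n -> acyclic (@adj X) ->
  (forall x y z, link n v x y -> link n v y z -> ~~ link n v x z) -> acyclic (link n v).
Proof.
move=> n3 ac nt [|a [|b [|c t]]] //= us _ /and3P[ab bc pt].
have nb x y : link n v x y -> adj v x by case/and3P.
have [va vb] : adj v a /\ adj v b by rewrite (nb _ _ ab) (nb _ _ bc).
have vc : adj v c by rewrite (nb _ b) // link_sym.
case: t us pt => [|d t] /= us; first by rewrite andbT link_sym (negPf (nt _ _ _ ab bc)).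
case/andP=> cd _; have vd : adj v d by rewrite (nb _ c) // link_sym.
have [ac' bd'] : a != c /\ b != d.
  by move: us; rewrite !inE !negb_or => /and4P[/and4P[_ -> _ _] /and3P[_ -> _] _ _].
have nac : ~~ connect (away v) a c by apply: contra ac' => /(acyclic_away ac va vc)->.
have nbd : ~~ connect (away v) b d by apply: contra bd' => /(acyclic_away ac vb vd)->.
have := link_chord n3 ab cd nac nbd.
by rewrite (negPf (nt _ _ _ ab bc)) (negPf (nt _ _ _ bc cd)).
Qed.

(* In a forest every edge away from [v] lies beyond a unique neighbour of [v]; sending it
   to that neighbour maps a walk of [HL n X] to a walk in the link of [v]. *)
Lemma acyclic_HL n (X : sgraph) : acyclic (@adj X) ->
  (forall v : X, acyclic (link n v)) -> acyclic (@adj (HL n X)).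
Proof.
move=> ac acl s us ss cs.
have [E1 s1] : exists E, E \in s by case: s ss {us cs} => // E s; exists E; rewrite mem_head.
have := cycle_connect_del us ss (@adj_sym (HL n X)) cs s1.
have := next_cycle cs s1; move: (next s E1) => E2 a12 /connectP[p pp lp].
have [v [x [y [V1 V2 l]]]] := path_adjacent_link (valP E1) (valP E2) a12.
have [vx [vy _]] := and3P l.
pose beyond z (g : {set X}) := adj v z /\ forall u, u \in g -> u != v -> connect (away v) z u.
have at_v z w : beyond z [set v; w] -> adj v w -> z = w.
  by move=> [vz bz] vw; apply: (acyclic_away ac vz vw); apply: bz; rewrite ?set22 // eq_sym adj_neq.
have beyond0 z : adj v z -> beyond z [set v; z].
  by move=> vz; split=> // u; rewrite !inE => /orP[]/eqP->; rewrite ?eqxx // connect0.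
have step z (g g' : HL n X) : beyond z (val g) -> del (@adj (HL n X)) E1 E2 g g' ->
    exists2 z', beyond z' (val g') & z = z' \/ del (link n v) x y z z'.
  move=> bz /andP[/(path_adjacent_link (valP g) (valP g'))[w [a [b [G G' lw]]]] ne].
  have [wa [wb _]] := and3P lw; rewrite G in bz.
  have [wv|wv] := eqVneq w v.
    rewrite {w}wv in G G' lw wa wb bz; have za := at_v _ _ bz wa.
    exists b; first by rewrite G'; exact: beyond0.
    right; rewrite za /del lw /=; apply: contraNneq ne => /eqP.
    rewrite eq_set2 => /orP[]/andP[/eqP ax /eqP bY]; apply/eqP.
      have -> : g = E1 by apply: val_inj; rewrite G V1 ax.
      by have -> : g' = E2 by apply: val_inj; rewrite G' V2 bY.
    have -> : g = E2 by apply: val_inj; rewrite G V2 ax.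
    have -> : g' = E1 by apply: val_inj; rewrite G' V1 bY.
    by rewrite setUC.
  have zw : connect (away v) z w by case: bz => _; apply; rewrite ?set21.
  exists z; last by left.
  rewrite G'; have [vz _] := bz; split=> // u.
  rewrite !inE => /orP[]/eqP-> // bv; apply: connect_trans zw (connect1 _).
  by rewrite /away wb wv.
have walk z g : beyond z (val g) -> path (del (@adj (HL n X)) E1 E2) g p ->
    val (last g p) = [set v; y] -> connect (del (link n v) x y) z y.
  elim: p z g {pp lp} => [|h p IH] z g bz /=.
    by move=> _ gy; rewrite [val g]gy in bz; rewrite (at_v _ _ bz vy).
  case/andP=> gh ph lh; have [z' bz' zz] := step _ _ _ bz gh.
  have c := IH _ _ bz' ph lh; case: zz => [->//|d].
  exact: connect_trans (connect1 d) c.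
(* The cycle without its adjacency between [E1] and [E2] becomes a walk from [x] to [y] in the link
   without [xy], which closes to a cycle of the link. *)
have c : connect (del (link n v) x y) x y.
  by apply: (walk x E1) => //; [rewrite V1; exact: beyond0 | rewrite -lp].
have [q [uq sq _] cq] := connect_del_cycle (@link_sym n X v) (@link_irr n X v) l c.
exact: (acl v _ uq sq cq).
Qed.

(** A nonempty forest has fewer edges than vertices, so [HL] shrinks it; the induction on size
    continues as long as no link has a triangle, and a triangle in a link yields a spider. *)
Lemma acyclic_dichotomy n (X : sgraph) : 4 <= n -> acyclic (@adj X) ->
  terminates n X \/ unbounded n X.
Proof.
move=> n4; have n3 : 3 <= n by exact: ltnW.
have [m] := ubnP #|X|; elim: m X => // m IH X lt ac.
have [X0|X0] := posnP #|X|; first by left; exists 0.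
case: (boolP [exists v, exists x, exists y, exists z : X,
    [&& link n v x y, link n v y z & link n v x z]]).
  case/existsP=> v /existsP[x /existsP[y /existsP[z /and3P[xy yz xz]]]]; right.
  have [vx [vy _]] := and3P xy; have [_ [vz _]] := and3P yz.
  have nl a b : adj v a -> adj v b -> a != b -> ~~ connect (away v) a b.
    by move=> va vb; apply: contra => /(acyclic_away ac va vb)->.
  have u3 : uniq [:: x; y; z].
    by rewrite /= !inE negb_or (link_neq xy) (link_neq xz) (link_neq yz).
  by apply: (spider_unbounded n4 u3 xy yz xz); apply: nl; rewrite // (@link_neq n _ v).
move=> nt; have acH : acyclic (@adj (HL n X)).
  apply: acyclic_HL => // v; apply: acyclic_link => // x y z xy yz; apply: contra nt => xz.
  by do 4![apply/existsP; eexists]; apply/and3P; split; [exact: xy | exact: yz | exact: xz].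
have ltH : #|HL n X| < m.
  have := ncomp_narcs_acyclic (@adj_sym X) (@adj_irrefl X) ac.
  have nc : 0 < ncomp (@adj X).
    case/card_gt0P: X0 => x _.
    by apply/card_gt0P; exists (cclass (@adj X) x); apply: imset_f.
  by rewrite (narcs_card_HL n X); move: nc lt; clear; lia.
case: (IH _ ltH acH) => [[k t]|u]; last by right; exact: unbounded_HL.
by left; exists k.+1; rewrite HL_iterS.
Qed.

(** * The edge count and the exclusion of tree components *)

Lemma leq_narcs_HL n (G : sgraph) : narcs (@adj G) <= 2 * #|G| ->
  (forall v : G, exists w, adj v w) -> (forall v : G, acyclic (link n v)) ->
  narcs (@adj (HL n G)) <= 2 * #|HL n G|.
Proof.
move=> le dG ac; rewrite -narcs_card_HL.
have : narcs (@adj (HL n G)) + 2 * #|G| <= 2 * narcs (@adj G).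
  rewrite narcs_HL [in X in _ <= X]narcs_sum big_distrr /= mulnC -sum_nat_const -big_split /=.
  by apply: leq_sum => v _; have [w vw] := dG v; exact: acyclic_link_narcs vw (ac v).
by move: le; clear; lia.
Qed.

Theorem theorem3p11 (n : nat) (G : sgraph) (hn : 4 <= n)
  (hG : minimally_convergent n G)
  (hgirth : girth_gt (HL n G) 4)
  (huni : all_components_unicyclic G) :
  all_components_unicyclic (HL n G).
Proof.
have n3 : 3 <= n by exact: ltnW.
have acl (v : G) : acyclic (link n v) by exact: unicyclic_link_acyclic.
have leG : narcs (@adj G) <= 2 * #|G|.
  by apply: leq_narcs_components => x; apply: unicyclic_narcs.
have leH : narcs (@adj (HL n G)) <= 2 * #|HL n G|.
  by apply: leq_narcs_HL leG _ acl => v; exact: components_deg v huni.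
suff geH (x : HL n G) : 2 * #|component x| <= narcs (@adj (component x)).
  move=> x; apply: connected_unicyclic (component_connected x) _.
  exact: geq_narcs_components.
rewrite leqNgt; apply/negP => ltx.
have ac := connected_acyclic (component_connected x) ltx.
pose K := cclass (@adj (HL n G)) x; pose F := [set val e | e in K].
have FP e (eE : e \in edges G) :
    (e \in F) = connect (@adj (HL n G)) x (exist (fun e => e \in edges G) e eE).
  apply/imsetP/idP => [[e' + E]|xe].
    by rewrite inE; congr connect; apply: val_inj.
  by exists (exist (fun e => e \in edges G) e eE); rewrite // inE.
have cF : {in edges G &, forall e1 e2, path_adjacent n e1 e2 -> (e1 \in F) = (e2 \in F)}.
  move=> e1 e2 E1 E2 a12; rewrite !FP.
  apply: same_connect_r; first exact/sym_connect_sym/adj_sym.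
  exact: connect1.
have restrG : emb (restr F) G by exists id => // a b /andP[].
(* [restr F] itself may contain a cycle of [G]; what is known to be a forest is its [HL]-graph,
   since it embeds into the tree. The dichotomy is therefore applied one step later. *)
have embK : emb (HL n (restr F)) (component x).
  have vE (e : HL n (restr F)) : (val e : {set G}) \in edges G :&: F.
    by rewrite -restr_edges (valP e).
  apply: (@emb_rel _ _ (fun (e : HL n (restr F)) (k : component x) =>
    (val e : {set G}) == val (val k))).
  - move=> e; have := vE e; rewrite in_setI => /andP[eE]; rewrite (FP _ eE) => xe.
    have kK : exist (fun e => e \in edges G) _ eE \in sub_vertices (induced K).
      by rewrite /sub_vertices /= inE.
    by exists (exist (fun k => k \in sub_vertices (induced K)) _ kK : component x).
  - by move=> e1 e2 k /eqP E1 /eqP E2; apply: val_inj; rewrite E1.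
  move=> e1 e2 k1 k2 a12 /eqP E1 /eqP E2; rewrite component_adj.
  rewrite [adj _ _]/(path_adjacent n (val (val k1)) (val (val k2))) -E1 -E2.
  have [v [a [b [V1 V2 /linkP l]]]] := path_adjacent_link (valP e1) (valP e2) a12.
  rewrite V1 V2; apply: paired_path_adjacent.
  have idh : {homo (id : restr F -> G) : u w / adj u w} by move=> u w /andP[].
  exact: (paired_map (X := restr F) (Y := G) (@inj_id _) idh l).
have acF := acyclic_emb embK ac.
case: (acyclic_dichotomy hn acF) => [[k t]|u].
  apply: (not_terminates_restr hG cF (valP x)).
    by apply/imsetP; exists x; rewrite // inE connect0.
  by exists k.+1; rewrite HL_iterS.
have [B leB] := convergent_bounded hG.1.
have [k ltk] := unbounded_emb restrG (unbounded_HL u) B.+1.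
by move: ltk; rewrite ltnNge leB.
Qed.
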